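(* Let $P$ be a kernel on $A$ such that $$\mathbb E\Big(\prod_{k\ge0}A_k(U_{-k}^{-1})^{-1}\Big)<\infty,$$ let $\mathbf X$ be the stationary chain compatible with $P$ and let $\mathbf X^{[k]}$ be its canonical $k$-steps Markov approximation. Then there exists a positive constant $C<+\infty$ such that, for every $k$, $$\bar d(\mathbf X,\mathbf X^{[k]})\le C\,\mathbb P\big(\ell(U_{-\infty}^0)>k\big).$$
   Context: Alphabet and pasts. $A=\{1,\dots,N\}$ with $N\in\{1,2,\dots\}\cup\{\infty\}$ ($A=\{1,2,\dots\}$ if $N=\infty$). $A^{-\mathbb N}$ is the set of pasts $\underline a=\ldots a_{-2}a_{-1}$; $a_{-k}^{-1}=a_{-k}\ldots a_{-1}$ (empty string if $k=0$). Concatenation is written in temporal order: $\underline z a_{-k}^{-1}$ is the past whose last $k$ symbols are $a_{-k}^{-1}$, preceded by $\underline z$. Kernels, chains. A kernel is a (measurable) function $P:A\times A^{-\mathbb N}\to[0,1]$ with $\sum_{a\in A}P(a|\underline x)=1$ for all $\underline x$. A stationary chain $\mathbf X=(X_n)_{n\in\mathbb Z}$ with law $\mu$ on $A^{\mathbb Z}$ is compatible with $P$ if $\mu(X_0=a|X_{-\infty}^{-1}=\underline x)=P(a|\underline x)$ for all $a$ and $\mu$-a.e. $\underline x$. The canonical $k$-steps Markov approximation $\mathbf X^{[k]}$ ($k\ge0$) is the stationary $k$-step Markov chain (i.i.d. if $k=0$) compatible with $P^{[k]}(a|x_{-k}^{-1})=\mu(X_0=a|X_{-k}^{-1}=x_{-k}^{-1})$,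 with $(X^{[k]}_1,\dots,X^{[k]}_k)$ distributed as $(X_1,\dots,X_k)$. For stationary chains, $\bar d(\mathbf X,\mathbf Y)=\inf\mathbb P(\bar X_0\ne\bar Y_0)$, infimum over all couplings $(\bar{\mathbf X},\bar{\mathbf Y})$ of $\mathbf X$ and $\mathbf Y$. Notation. $\alpha_k(a|a_{-k}^{-1})=\inf_{\underline z}P(a|\underline z a_{-k}^{-1})$, $\alpha_k(a_{-k}^{-1})=\sum_{a\in A}\alpha_k(a|a_{-k}^{-1})$, and $\alpha_0=\sum_{a\in A}\inf_{\underline z}P(a|\underline z)$. $(U_n)_{n\in\mathbb Z}$ are i.i.d. uniform on $[0,1[$. Let $I(1|\emptyset),I(2|\emptyset),\dots$ be consecutive left-closed right-open intervals partitioning $[0,\alpha_0[$, in this order from left to right, with $|I(a|\emptyset)|=\alpha_0(a|\emptyset)=\inf_{\underline z}P(a|\underline z)$. For $k\ge1$, $$J_k(U_{-k}^{-1})=\{\underline x\in A^{-\mathbb N}:\ \forall 1\le l\le k,\ x_{-l}=a \text{ if } U_{-l}\in I(a|\emptyset)\text{ for some }a\in A\},$$ $A_0=\alpha_0$ and, for $k\ge1$, $A_k(U_{-k}^{-1})=\inf\{\alpha_k(x_{-k}^{-1}):\underline x\in J_k(U_{-k}^{-1})\}$ (with $1/0=\infty$). Finally $\ell(U_{-\infty}^0)=\inf\{j\ge0:U_0<A_j(U_{-j}^{-1})\}$ (with $\inf\emptyset=\infty$). *)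

(* Defs.v *)
From HB Require Import structures.
From mathcomp Require Import all_boot all_order all_algebra.
From mathcomp Require Import all_classical all_reals all_analysis.
Set Implicit Arguments.
Unset Strict Implicit.
Unset Printing Implicit Defensive.
Import Order.TTheory GRing.Theory Num.Theory.
Import numFieldNormedType.Exports.
Local Open Scope classical_set_scope.
Local Open Scope ring_scope.

(* N in {1, 2, ...} (Some) or N = infinity (None). *)
Definition alphabet_size := option {n : nat | (0 < n)%N}.

Definition is_letter (N : alphabet_size) : pred nat :=
  fun a => (0 < a)%N && (if N is Some n then (a <= val n)%N else true).

Definition letter (N : alphabet_size) := {a : nat | is_letter N a}.

HB.instance Definition _ N := Countable.on (letter N).

Lemma is_letter1 N : is_letter N 1%N.
Proof. by case: N => [[n n0]|]. Qed.

HB.instance Definition _ N :=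
  isPointed.Build (letter N) (exist _ 1%N (is_letter1 N)).

HB.instance Definition _ N := @isMeasurable.Build default_measure_display
  (letter N) discrete_measurable discrete_measurable0
  discrete_measurableC discrete_measurableU.

(* Generate the product sigma-algebra on T^I for a discrete T. *)
Definition cylinders (I T : Type) : set (set (I -> T)) :=
  [set C | exists i (B : set T), C = (fun w : I -> T => w i) @^-1` B].

(* A bi-infinite path w has letter w n at time n. A past x has x i = x_{-(i+1)},
   that is, x 0 is the most recent letter. *)
Notation path_space N := (g_sigma_algebraType (@cylinders int (letter N))).
Notation past_space N := (g_sigma_algebraType (@cylinders nat (letter N))).

Section chains.
Context {R : realType} {N : alphabet_size}.
Local Notation A := (letter N).
Local Notation past := (past_space N).
Local Notation path := (path_space N).
Local Open Scope ereal_scope.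
Implicit Types (P : A -> past -> R) (mu nu : probability path R).

Record is_kernel P : Prop := IsKernel {
  kernel_measurable : measurable_fun setT (fun ax : A * past => P ax.1 ax.2) ;
  kernel_itv : forall a x, (0 <= P a x <= 1)%R ;
  kernel_sum1 : forall x, \esum_(a in [set: A]) (P a x)%:E = 1 }.

Definition time_shift (w : path) : path := fun n => w (n + 1)%R.

Definition past_of (w : path) : past := fun i => w (- (i.+1)%:Z)%R.

Definition stationary mu :=
  forall B : set path, measurable B -> mu (time_shift @^-1` B) = mu B.

(* P (a | .) is a version of mu (X_0 = a | X_{-oo}^{-1} = .). *)
Definition compatible mu P :=
  forall a (B : set past), measurable B ->
    mu ([set w | w 0%R = a] `&` past_of @^-1` B) =
    \int[mu]_(w in past_of @^-1` B) (P a (past_of w))%:E.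

(* A string a_{-k}^{-1} is represented by any past ending with it, so functions
   of the string are functions of a past that only look at its last k letters. *)
Definition last_block (k : nat) (x : past) : set path :=
  [set w | forall i, (i < k)%N -> past_of w i = x i].

(* P^[k] ; its value 0 at strings of mu-probability 0 is irrelevant. *)
Definition markov_kernel mu (k : nat) (a : A) (x : past) : R :=
  (fine (mu ([set w | w 0 = a] `&` last_block k x)) /
   fine (mu (last_block k x)))%R.

Definition block1 (k : nat) (w : path) : 'I_k -> A := fun i => w (i.+1)%:Z.

Record canonical_markov (k : nat) mu nu : Prop := CanonicalMarkov {
  canonical_stationary : stationary nu ;
  canonical_compatible : compatible nu (markov_kernel mu k) ;
  canonical_block : forall B : set ('I_k -> A),
    nu (@block1 k @^-1` B) = mu (@block1 k @^-1` B) }.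

(* Couplings are joint stationary chains, as in Ornstein's d-bar distance.
   Without joint stationarity the infimum would only compare the laws of X_0
   and Y_0, and would vanish whenever these agree. *)
Record stationary_coupling mu nu (pi : probability (path * path)%type R) :
    Prop := StationaryCoupling {
  coupling_fst : forall B : set path, measurable B -> pi (fst @^-1` B) = mu B ;
  coupling_snd : forall B : set path, measurable B -> pi (snd @^-1` B) = nu B ;
  coupling_stationary : forall C : set (path * path), measurable C ->
    pi ((fun w : path * path => (time_shift w.1, time_shift w.2)) @^-1` C) = pi C }.

Definition dbar mu nu : \bar R :=
  ereal_inf [set pi [set w : path * path | w.1 0%R != w.2 0%R]
            | pi in stationary_coupling mu nu].

(* The past  z x_{-k}^{-1}. *)
Definition splice (k : nat) (z x : past) : past :=
  fun i => if (i < k)%N then x i else z (i - k)%N.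

Definition alpha_letter P (k : nat) (a : A) (x : past) : \bar R :=
  ereal_inf [set (P a (splice k z x))%:E | z in [set: past]].

Definition alpha P (k : nat) (x : past) : \bar R :=
  \esum_(a in [set: A]) alpha_letter P k a x.

Definition alpha0_letter P (a : A) : \bar R :=
  ereal_inf [set (P a z)%:E | z in [set: past]].

Definition alpha0 P : \bar R := \esum_(a in [set: A]) alpha0_letter P a.

(* I(a|empty string). *)
Definition interval0 P (a : A) : set R :=
  [set u | \esum_(b in [set b : A | (val b < val a)%N]) alpha0_letter P b
             <= u%:E <
           \esum_(b in [set b : A | (val b <= val a)%N]) alpha0_letter P b].

(* J_k(U_{-k}^{-1}) ; the sequence u is only used at times -k, ..., -1. *)
Definition J P (k : nat) (u : int -> R) : set past :=
  [set x | forall i a, (i < k)%N -> interval0 P a (u (- (i.+1)%:Z)%R) ->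
     x i = a].

Definition A_inf P (k : nat) (u : int -> R) : \bar R :=
  if k is 0%N then alpha0 P else ereal_inf [set alpha P k x | x in J P k u].

Definition ell P (u : int -> R) : \bar R :=
  ereal_inf [set (j%:R)%:E | j in [set j : nat | (u 0%R)%:E < A_inf P j u]].

(* The partial products are nondecreasing in [1, +oo], and 0^-1 = +oo in \bar R. *)
Definition inv_prod P (u : int -> R) : \bar R :=
  limn (fun n => \prod_(0 <= k < n) (A_inf P k u)^-1).

End chains.

Record iid_uniform (R : realType) d (Omega : measurableType d)
    (Pr : probability Omega R) (U : int -> {RV Pr >-> R}) : Prop := IidUniform {
  iid_independent : forall (s : seq int) (B : int -> set R), uniq s ->
    (forall n, measurable (B n)) ->
    Pr (\bigcap_(n in [set` s]) (U n @^-1` B n)) =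
    (\prod_(n <- s) Pr (U n @^-1` B n))%E ;
  iid_law : forall n (B : set R), measurable B ->
    Pr (U n @^-1` B) = lebesgue_measure (B `&` `[0, 1[) }.

(* Main.v *)
(* Every draw [u_j] decides the letter at time [j] through a partition of [0, 1[
   whose part below [alpha_l] only depends on the last [l] letters. Using the
   same draws, and transition probabilities of [mu] given the letters since the
   start (resp. given the last [k] of them), one builds from any starting time
   a chain with the law of X (resp. of X^[k]). Say that a start at [m] is good
   up to [n] if no draw in [m, n] needs letters from before [m]; then the letters
   in [m, n] do not depend on the past, so both chains have limits as the start
   goes to -oo, and these limits are a stationary coupling. They differ at time
   0 only if, for some [n], the draw at [-n] has [ell > k] and no start in
   ]-n, 0] is good up to 0. These two events are independent, and the
   probabilities of the second ones have sum at most [1 / p], where [p] is the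
   probability that a start is good forever: "no good start in ]0, n], and a
   start at [n + 1] which is good forever" are disjoint events. Hence
   [C = 1 / p]. Finally [p > 0]: the hypothesis bounds
   [sum_k P (ell > k) = sum_k E (1 - A_k)], so that from some time on no draw
   looks too far back with positive probability; forcing the finitely many other
   draws below [alpha_0] only shrinks the sets [J]. *)
Require Import Defs.
From mathcomp Require Import all_boot all_order all_algebra.
From mathcomp Require Import lra zify.
From mathcomp Require Import all_classical all_reals all_analysis.
From mathcomp Require Import measurable_realfun.
Import Order.TTheory GRing.Theory Num.Theory.
Import numFieldNormedType.Exports.
Set Implicit Arguments.
Unset Strict Implicit.
Unset Printing Implicit Defensive.
Local Open Scope classical_set_scope.
Local Open Scope ring_scope.

(** * Independent uniform draws *)

Lemma measurable_fun_cylinders d (X : measurableType d) (I : Type)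
  (T : pointedType)
    (f : X -> g_sigma_algebraType (@cylinders I T)) :
  (forall i (B : set T), measurable [set x | B (f x i)]) ->
  measurable_fun setT f.
Proof.
move=> mf; apply: (@measurability _ _ X (g_sigma_algebraType
  (@cylinders I T)) setT f
  (@cylinders I T)) => //.
by move=> _ [_ [i [B ->]] <-]; rewrite setTI; exact: mf.
Qed.

Lemma measurable_coord_preimage (I : Type) (T : pointedType) (i : I) (B : set T) :
  measurable [set w : g_sigma_algebraType (@cylinders I T) | B (w i)].
Proof. by apply: sub_sigma_algebra; exists i, B. Qed.

Definition image_law d d' (T : measurableType d) (T' : measurableType d')
    (R : realType) (P : probability T R) (f : T -> T')
    (mf : measurable_fun setT f) : probability T' R :=
  distribution P (mfun_Sub (mem_set mf)).

Lemma image_lawE d d' (T : measurableType d) (T' : measurableType d')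
    (R : realType) (P : probability T R) (f : T -> T')
    (mf : measurable_fun setT f) S : image_law P mf S = P (f @^-1` S).
Proof. by []. Qed.

Definition borel_cylinders (R : realType) : set (set (int -> R)) :=
  [set C | exists i (B : set R), measurable B /\ C = (fun u => u i) @^-1` B].
Arguments borel_cylinders R : clear implicits.

Notation noise R := (g_sigma_algebraType (borel_cylinders R)).

Definition translate (T : Type) (j : int) (u : int -> T) : int -> T :=
  fun i => u (i + j).

Lemma translate_translate (T : Type) i j (u : int -> T) :
  translate i (translate j u) = translate (i + j) u.
Proof. by apply/funext => n; rewrite /translate addrA. Qed.

Section noise.
Context {R : realType}.
Implicit Types (s : seq int) (B : int -> set R).

Definition rect s B : set (noise R) := [set u | forall i, i \in s -> B i (u i)].

Lemma measurable_coord i : measurable_fun setT (fun u : noise R => u i).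
Proof.
by move=> _ B mB; rewrite setTI; apply: sub_sigma_algebra; exists i, B.
Qed.

Lemma measurable_fun_noise d (T : measurableType d) (f : T -> noise R) :
  (forall i, measurable_fun setT (fun t => f t i)) -> measurable_fun setT f.
Proof.
move=> mf; apply: (@measurability _ _ T (noise R) setT f
  (borel_cylinders R)) => //.
move=> _ [_ [i [B [mB ->]]] <-]; rewrite -comp_preimage.
exact: (mf i measurableT _ mB).
Qed.

Lemma measurable_translate j : measurable_fun setT (translate j : noise R ->
  noise R).
Proof. by apply: measurable_fun_noise => i; exact: measurable_coord. Qed.

Lemma rectE s B : rect s B = \bigcap_(i in [set` s]) ((fun u => u i) @^-1` B i).
Proof. by []. Qed.

Lemma measurable_rect s B : (forall i, measurable (B i)) ->
  measurable (rect s B).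
Proof.
move=> mB; rewrite rectE; apply: fin_bigcap_measurable => // i _.
by rewrite -[X in measurable X]setTI; exact: measurable_coord.
Qed.

Definition rects : set (set (noise R)) :=
  [set S | exists s B, [/\ uniq s, forall i, measurable (B i) & S = rect s B]].

Lemma noise_measurableE : @measurable _ (noise R) = <<s rects >>.
Proof.
apply/seteqP; split.
  apply: smallest_sub; first exact: smallest_sigma_algebra.
  move=> _ [i [B [mB ->]]]; apply: sub_sigma_algebra.
  exists [:: i], (fun=> B); split => //.
  by apply/seteqP; split => u /= H; [move=> j /[!inE] /eqP ->|apply: H;
    rewrite inE].
apply: smallest_sub; first exact: sigma_algebra_measurable.
by move=> _ [s [B [_ mB ->]]]; exact: measurable_rect.
Qed.

Lemma rects_setI : setI_closed rects.
Proof.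
move=> _ _ [s [B [us mB ->]]] [s' [B' [us' mB' ->]]].
pose C i := (if i \in s then B i else setT) `&` (if i \in s' then B' i else setT).
exists (undup (s ++ s')), C; split; first exact: undup_uniq.
  by move=> i; apply: measurableI; case: ifP.
apply/seteqP; split => u /=.
  move=> [h h'] i; rewrite mem_undup mem_cat /C => _.
  by split; case: ifP => //; [exact: h|exact: h'].
move=> h; split => i is_; have := h i; rewrite mem_undup mem_cat is_ ?orbT /C.
  by case=> //; rewrite is_.
by case=> // _; rewrite is_.
Qed.

Lemma noise_measure_unique (m1 m2 : {measure set (noise R) -> \bar R}) :
  (m1 setT < +oo)%E ->
  (forall s B, uniq s -> (forall i, measurable (B i)) ->
    m1 (rect s B) = m2 (rect s B)) ->
  forall S, measurable S -> m1 S = m2 S.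
Proof.
move=> m1oo m12 S mS.
apply: (measure_unique rects (fun=> setT) noise_measurableE rects_setI) => //.
- move=> _; exists [::], (fun=> setT); split => //.
  by apply/seteqP; split.
- by rewrite bigcup_const //; exists 0%N.
- by move=> _ [s [B [us mB ->]]]; exact: m12.
Qed.

Definition unif (B : set R) : \bar R := lebesgue_measure (B `&` `[0, 1[).

Definition iid_noise (lam : probability (noise R) R) :=
  forall s B, uniq s -> (forall i, measurable (B i)) ->
    lam (rect s B) = (\prod_(i <- s) unif (B i))%E.

Context (lam : probability (noise R) R) (lamE : iid_noise lam).

Lemma iid_translate j (S : set (noise R)) : measurable S ->
  lam (translate j @^-1` S) = lam S.
Proof.
move=> mS; pose m := image_law lam (@measurable_translate j).
apply: (@noise_measure_unique m lam) => //.
  by rewrite [X in (X < _)%E](probability_setT m) ltry.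
move=> s B us mB.
transitivity (lam (rect [seq i + j | i <- s] (fun i => B (i - j)))).
  congr (lam _); apply/seteqP; split => u /=.
    by move=> h _ /mapP[i is_ ->]; rewrite addrK; exact: h.
  by move=> h i is_; have := h _ (map_f (+%R^~ j) is_); rewrite addrK.
rewrite lamE// ?map_inj_uniq//; last exact: addIr.
rewrite big_map; under eq_bigr do rewrite addrK.
exact/esym/lamE.
Qed.

Definition mix_noise (I : pred int) (p : noise R * noise R) : noise R :=
  fun i => if I i then p.1 i else p.2 i.

Lemma measurable_mix_noise I : measurable_fun setT (mix_noise I).
Proof.
apply: measurable_fun_noise => i; rewrite /mix_noise; case: (I i).
  exact: (measurableT_comp (measurable_coord i) measurable_fst).
exact: (measurableT_comp (measurable_coord i) measurable_snd).
Qed.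

(** Both sides are measures agreeing on rectangles, where the product over [s] splits into the
    coordinates inside and outside [I]. Resampling the coordinates outside [I] in this way is how
    independence enters the proof. *)
Lemma iid_mix_noise I (S : set (noise R)) : measurable S ->
  (lam \x lam)%E (mix_noise I @^-1` S) = lam S.
Proof.
move=> mS.
pose m := image_law (lam \x lam)%E (@measurable_mix_noise I).
apply: (@noise_measure_unique m lam) => //.
  by rewrite [X in (X < _)%E](probability_setT m) ltry.
move=> s B us mB.
transitivity ((lam \x lam)%E
    (rect [seq i <- s | I i] B `*` rect [seq i <- s | ~~ I i] B)).
  congr ((lam \x lam)%E _); apply/seteqP; split => -[u v] /=.
    by move=> h; split => i /=; rewrite mem_filter => /andP[Ii /h] /=;
      rewrite /mix_noise ?Ii ?(negPf Ii).
  move=> [h h'] i is_; rewrite /mix_noise /=; case: ifPn => Ii.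
    by apply: h; rewrite mem_filter Ii.
  by apply: h'; rewrite mem_filter Ii.
rewrite product_measure1E; [|exact: measurable_rect..].
transitivity ((\prod_(i <- [seq i <- s | I i]) unif (B i)) *
    \prod_(i <- [seq i <- s | ~~ I i]) unif (B i))%E.
  by congr (_ * _)%E; apply: lamE => //; exact: filter_uniq.
rewrite !big_filter; transitivity (\prod_(i <- s) unif (B i))%E.
  by rewrite [RHS](bigID I).
exact/esym/lamE.
Qed.

(** After resampling outside [I], [S1] only sees the first copy of the noise and [S2] only the
    second, so their intersection becomes a rectangle for the product measure. *)
Lemma iid_indep (I : pred int) (S1 S2 : set (noise R)) :
  measurable S1 -> measurable S2 ->
  (forall u v, (forall i, I i -> u i = v i) -> S1 u -> S1 v) ->
  (forall u v, (forall i, ~~ I i -> u i = v i) -> S2 u -> S2 v) ->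
  lam (S1 `&` S2) = (lam S1 * lam S2)%E.
Proof.
move=> mS1 mS2 d1 d2; rewrite -(@iid_mix_noise I); last exact: measurableI.
rewrite -product_measure1E//; congr ((lam \x lam)%E _); apply/seteqP;
  split => -[u v] /=.
  move=> [h1 h2]; split.
    by apply: d1 h1 => i Ii; rewrite /mix_noise Ii.
  by apply: d2 h2 => i Ii; rewrite /mix_noise (negPf Ii).
move=> [h1 h2]; split.
  by apply: d1 h1 => i Ii; rewrite /mix_noise Ii.
by apply: d2 h2 => i Ii; rewrite /mix_noise (negPf Ii).
Qed.

Lemma iid_coord i (B : set R) : measurable B ->
  lam [set u | B (u i)] = unif B.
Proof.
move=> mB; have := @lamE [:: i] (fun=> B) isT (fun=> mB).
rewrite big_seq1 => <-; congr (lam _); apply/seteqP; split => u /=.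
  by move=> h j; rewrite inE => /eqP ->.
by apply; rewrite inE.
Qed.

End noise.

(** * Events depending on finitely many letters *)

Section countable_valued.
Context d (T : measurableType d) (C : countType).

Lemma measurable_preimage_countable (f : T -> C) (S : set C) :
  (forall c, measurable [set t | f t = c]) -> measurable [set t | S (f t)].
Proof.
move=> mf.
have -> : [set t | S (f t)] =
    \bigcup_(k in [set k | if @pickle_inv C k is Some c then S c else False])
      [set t | @pickle_inv C k = Some (f t)].
  apply/seteqP; split => t /=.
    by move=> St; exists (pickle (f t)) => /=; rewrite pickleK_inv.
  by move=> [k /=]; case: pickle_inv => // c Sc [<-].
apply: bigcup_measurable => k _; case: (@pickle_inv C k) => [c|].
  by have := mf c; congr measurable; apply/seteqP; split => t /= [->].
by rewrite (_ : mkset _ = set0)//; apply/seteqP; split.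
Qed.

Lemma measurable_xget (E : C -> set T) (c0 : C) :
  (forall c, measurable (E c)) -> (forall t c c', E c t -> E c' t -> c = c') ->
  forall c, measurable [set t | xget c0 [set c | E c t] = c].
Proof.
move=> mE Einj c.
have xgetE t c' : E c' t -> xget c0 [set c | E c t] = c'.
  by move=> Ect; apply: xget_unique => // c'' /Einj; exact.
have [->|cc0] := eqVneq c c0; last first.
  rewrite (_ : mkset _ = E c)//; apply/seteqP; split => t /=; last exact: xgetE.
  by case: xgetP => [b _ Et <-//|_ h]; rewrite h eqxx in cc0.
(* The value [c0] also arises by default, so its preimage is the complement of the union of the
   [E c] with [c != c0]. *)
rewrite (_ : mkset _ =
    ~` \bigcup_(k in [set k | if @pickle_inv C k is Some c then c != c0 else
      False])
      (if @pickle_inv C k is Some c then E c else set0)).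
  apply: measurableC; apply: bigcup_measurable => k _.
  by case: pickle_inv.
apply/seteqP; split => t /=.
  move=> h [k /=]; case: pickle_inv => // b bc0 /xgetE h'.
  by rewrite -h h' eqxx in bc0.
move=> h; apply: contrapT => /eqP nc0; apply: h.
case: xgetP nc0 => [b _ Et bc0|_]; last by rewrite eqxx.
by exists (pickle b); rewrite /= pickleK_inv.
Qed.

End countable_valued.

Section strings.
Context (C : countType) (c0 : C).

Definition depends_on_first (L : nat) (S : set (nat -> C)) :=
  forall x y, (forall i, (i < L)%N -> x i = y i) -> S x -> S y.

Definition same_first (L : nat) (x y : nat -> C) :=
  forall i, (i < L)%N -> y i = x i.

Definition string_past L (t : L.-tuple C) : nat -> C := nth c0 t.

(** Cuts an event on the first [L] letters into countably many disjoint cylinders, one for each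
    string of length [L] in [S]; the index [k] is the code of the string. *)
Definition piece (T : Type) (h : T -> nat -> C) L S (k : nat) : set T :=
  if @pickle_inv (L.-tuple C) k is Some t then
    if `[< S (string_past t) >] then [set w | same_first L (string_past t)
      (h w)] else set0
  else set0.

Lemma same_first_string (T : Type) (h : T -> nat -> C) L w :
  same_first L (string_past [tuple h w i | i < L]) (h w).
Proof.
move=> i iL; rewrite /string_past -[i in RHS]/(val (Ordinal iL)) -tnth_nth.
by rewrite tnth_mktuple.
Qed.

Context d (T : measurableType d) (h : T -> nat -> C).
Hypothesis mh : forall i c, measurable [set w | h w i = c].

Lemma measurable_same_first L x : measurable [set w | same_first L x (h w)].
Proof.
rewrite (_ : mkset _ = \bigcap_(i in `I_L) [set w | h w i = x i])//.
by apply: fin_bigcap_measurable.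
Qed.

Lemma piece_cover L (S : set (nat -> C)) : depends_on_first L S ->
  [set w | S (h w)] = \bigcup_k piece h L S k.
Proof.
move=> dS; apply/seteqP; split => w /=.
  move=> Sw; pose t := [tuple h w i | i < L].
  exists (pickle t) => //; rewrite /piece pickleK_inv asboolT;
    first exact: same_first_string.
  by apply: dS Sw => i iL; rewrite (same_first_string h w iL).
move=> [k _]; rewrite /piece; case: pickle_inv => // t.
by case: ifPn => // /asboolP St h1; apply: dS St => i iL; rewrite h1.
Qed.

Lemma measurable_piece L S k : measurable (piece h L S k).
Proof.
rewrite /piece; case: pickle_inv => // t; case: ifP => // _.
exact: measurable_same_first.
Qed.

Lemma measurable_depends_on_first L (S : set (nat -> C)) :
  depends_on_first L S -> measurable [set w | S (h w)].
Proof.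
move=> /piece_cover ->; apply: bigcup_measurable => k _.
exact: measurable_piece.
Qed.

Lemma trivIset_piece L S : trivIset setT (piece h L S).
Proof.
apply/trivIsetP => i j _ _ ij; apply/seteqP; split => // w [] /=.
rewrite /piece; have := @pickle_invK (L.-tuple C) i.
have := @pickle_invK (L.-tuple C) j.
case: pickle_inv => // t /= tj; case: pickle_inv => // t' /= t'i.
case: ifP => // _; case: ifP => // _ h1 h2.
suff tt' : t = t' by move: ij; rewrite -tj -t'i tt' eqxx.
apply/eq_from_tnth => a; rewrite !(tnth_nth c0).
by rewrite -[LHS](h2 a)// -[RHS](h1 a).
Qed.

End strings.

(** Both events split along the same countable family of strings, so the bounds on cylinders add
    up. *)
Lemma le_measure_strings (C : countType) (R : realType) d (T : measurableType d)
    d' (T' : measurableType d') (m : {measure set T -> \bar R})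
    (m' : {measure set T' -> \bar R}) (h : T -> nat -> C) (h' : T' -> nat -> C)
    (c0 : C) L (S : set (nat -> C)) :
  (forall i c, measurable [set w | h w i = c]) ->
  (forall i c, measurable [set w | h' w i = c]) ->
  (forall x, m [set w | same_first L x (h w)] <=
             m' [set w | same_first L x (h' w)])%E ->
  depends_on_first L S -> (m [set w | S (h w)] <= m' [set w | S (h' w)])%E.
Proof.
move=> mh mh' mm' dS; rewrite !(piece_cover c0 _ dS).
have mp := measurable_piece c0 mh L S.
have mp' := measurable_piece c0 mh' L S.
rewrite !measure_semi_bigcup//; [|exact: trivIset_piece|exact: bigcup_measurable
  |exact: trivIset_piece|exact: bigcup_measurable].
apply: lee_nneseries => k; first by move=> *; exact: measure_ge0.
move=> _.
rewrite /piece; case: pickle_inv => [t|]; last by rewrite !measure0.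
by case: ifP; rewrite ?measure0.
Qed.

(** * The update function *)

Lemma esum_subset (R : realType) (T : choiceType) (A B : set T) (f : T ->
  \bar R) :
  A `<=` B -> (\esum_(i in A) f i <= \esum_(i in B) f i)%E.
Proof.
move=> AB; apply: le_ereal_sup => _ [F [finF FA] <-].
by exists F => //; split => //; exact: subset_trans AB.
Qed.

Section quantile.
Context {R : realType} {N : alphabet_size}.
Local Notation A := (letter N).
Local Open Scope ereal_scope.
Implicit Types (w : A -> \bar R) (a b : A) (t c : \bar R).

Definition below w a := \esum_(b in [set b : A | (val b < val a)%N]) w b.
Definition upto w a := \esum_(b in [set b : A | (val b <= val a)%N]) w b.

(** Inverse distribution function of the weights [w]. The default letter [point] is only reached
    when [t] lies outside the range covered by the weights. *)
Definition quantile w t : A := xget point [set a | below w a <= t < upto w a].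

Lemma uptoE w a : (forall b, 0 <= w b) -> upto w a = below w a + w a.
Proof.
move=> w0; rewrite /upto (esumID [set a])//.
rewrite addeC; congr (_ + _).
  congr (esum _ _); apply/seteqP; split => b /=.
    by move=> [ba nba]; rewrite ltn_neqAle ba andbT; apply/eqP => /val_inj.
  by move=> ba; split; [exact: ltnW|move=> ab; rewrite ab ltnn in ba].
rewrite -[RHS](@esum_set1 _ _ a w)//; congr (esum _ _); apply/seteqP;
  split => b /=.
  by case.
by move=> ->.
Qed.

Lemma upto_le_below w a b : (val a < val b)%N -> upto w a <= below w b.
Proof. by move=> ab; apply: esum_subset => c /= ca; exact: leq_ltn_trans ab. Qed.

Lemma upto_le w a : upto w a <= \esum_(b in [set: A]) w b.
Proof. exact: esum_subset. Qed.

Lemma below_ge0 w a : (forall b, 0 <= w b) -> 0 <= below w a.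
Proof. by move=> w0; apply: esum_ge0. Qed.

Lemma quantile_inj w t a b : below w a <= t < upto w a ->
  below w b <= t < upto w b -> a = b.
Proof.
move=> /andP[a1 a2] /andP[b1 b2]; apply/val_inj.
case: (ltngtP (val a) (val b)) => // /(upto_le_below w) ab.
  by have := lt_le_trans a2 (le_trans ab b1); rewrite ltxx.
by have := lt_le_trans b2 (le_trans ab a1); rewrite ltxx.
Qed.

Lemma quantileE w t a : below w a <= t < upto w a -> quantile w t = a.
Proof.
by move=> h; apply: xget_unique => // b /quantile_inj; exact.
Qed.

Lemma letter_pred a : (1 < val a)%N -> exists b : A, val b = (val a).-1.
Proof.
case: a => n /= nN n1; have h : is_letter N n.-1.
  move: nN; rewrite /is_letter; case: N => [[m m0]|] /andP[n0 nm] /=.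
    by rewrite -ltnS prednK// n1 /=; rewrite (leq_trans _ nm)// leq_pred.
  by rewrite andbT -ltnS prednK.
by exists (exist (fun m => is_letter N m) _ h : A).
Qed.

(** A finite partial sum already exceeds [t], hence so does [upto w b] for some [b]. The least such
    letter works: [below] at this letter is [upto] at its predecessor, or 0 for the letter 1. *)
Lemma quantile_exists w t : (forall b, 0 <= w b) -> 0 <= t ->
  t < \esum_(b in [set: A]) w b -> exists a, below w a <= t < upto w a.
Proof.
move=> w0 t0 /ereal_sup_gt[_ [F [finF _] <-]] tF.

have [b tb] : exists b, t < upto w b.
  have [b Fb] : exists b : A, forall e : A, F e -> (val e <= val b)%N.
    have /finite_seqP[s ->] := finF; elim: s => [|e s [b bs]];
      first by exists point.
    have [eb|/ltnW be] := leqP (val e) (val b); [exists b|exists e] => e' /=;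
      rewrite inE => /predU1P[->//|/bs//] e'b.
    exact: leq_trans be.
  exists b; apply: (lt_le_trans tF); rewrite -esum_fset//.
  exact: esum_subset.
have [a ta amin] : exists2 a, t < upto w a &
    forall b, (val b < val a)%N -> upto w b <= t.
  have [n] := ubnP (val b); elim: n b tb => // n IH b tb bn.
  have [h|h] := pselect (forall c : A, (val c < val b)%N -> upto w c <= t).
    by exists b.
  have [c /not_implyP[cb /negP]] := (existsNP _).2 h.
  rewrite -ltNge => tc; apply: (IH c) => //.
  by rewrite (leq_trans cb).
exists a; rewrite ta andbT.
have [a1|a1] := leqP (val a) 1.
  rewrite /below (_ : mkset _ = set0) ?esum_set0//; apply/seteqP;
    split => // b' /=.
  move=> b'a; have := leq_trans b'a a1; rewrite ltnS leqn0.
  by case: b' {b'a} => -[].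
have [c cE] := letter_pred a1.
have ca : (val c < val a)%N by rewrite cE prednK// (ltn_trans _ a1).
apply: le_trans (amin c ca); apply: esum_subset => b' /= b'a.
by rewrite cE -ltnS prednK// (ltn_trans _ a1).
Qed.

Lemma measurable_quantile w c a :
  measurable [set v : R | quantile w (v%:E - c) = a].
Proof.
apply: (@measurable_xget _ R A
  (fun a => [set v | below w a <= v%:E - c < upto w a])).
- move=> b.
  pose h : R -> \bar R := fun v => v%:E - c.
  have mh : measurable_fun [set: R] h.
    by apply: emeasurable_funB => //; exact: measurable_cst.
  have -> : [set v : R | below w b <= v%:E - c < upto w b] =
      setT `&` h @^-1` [set` `[below w b, upto w b[].
    by apply/seteqP; split => v /=; rewrite in_itv/=; tauto.
  exact: mh measurableT _ (emeasurable_itv _).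
- by move=> v b b'; exact: quantile_inj.
Qed.

(** The draws in question lie in an interval of length [w a]. An upper bound is enough for what
    follows, since domination on all strings is turned into equality of laws by
    [stationary_law_unique]. *)
Lemma le_quantile_measure w c a : (forall b, 0 <= w b) ->
  c \is a fin_num -> \esum_(b in [set: A]) w b \is a fin_num ->
  lebesgue_measure ([set v : R | c <= v%:E < c + \esum_(b in [set: A]) w b]
    `&` [set v : R | quantile w (v%:E - c) = a]) <= w a.
Proof.
move=> w0 cf wf.
have upf b : upto w b \is a fin_num.
  rewrite ge0_fin_numE ?(le_lt_trans (upto_le _ _))//.
    by rewrite ltey_eq wf.
  exact: esum_ge0.
have bf b : below w b \is a fin_num.
  move: (upf b); rewrite uptoE// fin_numD => /andP[] //.
pose I : set R := `[(fine c + fine (below w a))%R, (fine c + fine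
  (upto w a))%R[%classic.
apply: (@le_trans _ _ (lebesgue_measure I)).
  apply: le_measure; rewrite ?inE.
  - apply: measurableI; last exact: measurable_quantile.
    rewrite (_ : mkset _ = `[fine c, fine
      (c + \esum_(b in [set: A]) w b)[%classic)//.
    apply/seteqP; split => v /=; rewrite in_itv/= -!lee_fin -lte_fin !fineK//;
    by rewrite fin_numD cf wf.
  - exact: measurable_itv.
  - move=> v /= [/andP[cv vc] qa].
    have [||b] := @quantile_exists w (v%:E - c) w0.
    + by rewrite sube_ge0// cf.
    + by rewrite lteBlDl.
    move=> /[dup] /quantileE; rewrite qa => <-.
    rewrite /I /= in_itv/= -!lee_fin -lte_fin !EFinD !fineK//.
    by rewrite leeBrDl// lteBlDl.
rewrite /I lebesgue_measure_itv/= {I}; case: ifP => // _.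
rewrite !EFinD !fineK// uptoE//.
have wa : w a \is a fin_num by move: (upf a); rewrite uptoE// fin_numD => /andP[].
move: (bf a) cf wa; case: (below w a) => // r _; case: c => // s _;
  case: (w a) => // z _.
by rewrite addeA -!EFinD lee_fin /=; lra.
Qed.

End quantile.

(** * Sampling a letter from a draw and a past *)

Section update.
Context {R : realType} {N : alphabet_size}.
Local Notation A := (letter N).
Local Notation past := (past_space N).
Local Open Scope ereal_scope.
Context (P : A -> past -> R) (hP : is_kernel P).
Implicit Types (a : A) (x y z : past) (k l : nat).

Lemma spliceK k x : splice k (fun i => x (i + k)%N) x = x.
Proof.
by apply/funext => i; rewrite /splice; case: ltnP => // ki; rewrite subnK.
Qed.

Lemma splice_same k z x y : same_first k x y -> splice k z x = splice k z y.
Proof.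
by move=> xy; apply/funext => i; rewrite /splice; case: ltnP => // /xy.
Qed.

Lemma alpha_letter_ge0 k a x : 0 <= alpha_letter P k a x.
Proof.
apply: le_ereal_inf_tmp => _ [z _ <-]; rewrite lee_fin.
by have /andP[] := kernel_itv hP a (splice k z x).
Qed.

Lemma alpha_letter_le k a x z : same_first k x z ->
  alpha_letter P k a x <= (P a z)%:E.
Proof.
move=> xz; apply: ereal_inf_lbound; exists (fun i => z (i + k)%N) => //.
by rewrite (splice_same _ xz) spliceK.
Qed.

Lemma alpha_letter_mono k l a x : (k <= l)%N ->
  alpha_letter P k a x <= alpha_letter P l a x.
Proof.
move=> kl; apply: le_ereal_inf_tmp => _ [z _ <-]; apply: alpha_letter_le => i ik.
by rewrite /splice (leq_trans ik kl).
Qed.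

Lemma alpha_letter_same k a x y : same_first k x y ->
  alpha_letter P k a x = alpha_letter P k a y.
Proof.
move=> xy; congr ereal_inf; apply/seteqP; split => _ [z _ <-]; exists z => //;
  by rewrite (splice_same _ xy).
Qed.

Lemma alpha_letter0 a x : alpha_letter P 0 a x = alpha0_letter P a.
Proof.
congr ereal_inf; apply/seteqP; split => _ [z _ <-]; exists z => //;
  by congr (P _ _)%:E; apply/funext => i; rewrite /splice subn0.
Qed.

Lemma alpha0E x : alpha P 0 x = alpha0 P.
Proof. by apply: eq_esum => a _; exact: alpha_letter0. Qed.

Lemma alpha_ge0 k x : 0 <= alpha P k x.
Proof. by apply: esum_ge0 => a _; exact: alpha_letter_ge0. Qed.

Lemma alpha_le1 k x : alpha P k x <= 1.
Proof.
rewrite -(kernel_sum1 hP x); apply: le_esum => a _; exact: alpha_letter_le.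
Qed.

Lemma alpha_fin k x : alpha P k x \is a fin_num.
Proof.
rewrite ge0_fin_numE ?alpha_ge0//; apply: le_lt_trans (alpha_le1 k x) _.
exact: ltry.
Qed.

Lemma alpha_letter_fin k a x : alpha_letter P k a x \is a fin_num.
Proof.
rewrite ge0_fin_numE ?alpha_letter_ge0//.
by apply: le_lt_trans (@alpha_letter_le k a x x _) (ltry _).
Qed.

Lemma alpha_mono k l x : (k <= l)%N -> alpha P k x <= alpha P l x.
Proof. by move=> kl; apply: le_esum => a _; exact: alpha_letter_mono. Qed.

Lemma alpha_same k x y : same_first k x y -> alpha P k x = alpha P k y.
Proof. by move=> xy; apply: eq_esum => a _; exact: alpha_letter_same. Qed.

(* Letters are assigned to [0, alpha_l x[ by consecutive slices: the slice
   [alpha_(j-1) x, alpha_j x[ is shared according to the increments of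
   alpha_j (a | x), so that below alpha_j only the last j letters matter. *)
Fixpoint sliced l (v : R) x : A :=
  if l is j.+1 then
    if v%:E < alpha P j x then sliced j v x
    else quantile (fun a => alpha_letter P j.+1 a x - alpha_letter P j a x)
           (v%:E - alpha P j x)
  else quantile (fun a => alpha_letter P 0 a x) (v%:E - 0).

(** Below [alpha P k x] the letter is read from the slices, which do not involve [p]; above it, the
    remaining mass [p - alpha_k] is shared out. Two rules with different [p] and [k] thus choose the
    same letter as soon as the draw is below some [alpha_l] with [l] at most both depths. *)
Definition update (p : A -> past -> R) k (v : R) x : A :=
  if v%:E < alpha P k x then sliced k v x
  else quantile (fun a => (p a x)%:E - alpha_letter P k a x)
         (v%:E - alpha P k x).

Lemma sliced_prefix l k v x : (l <= k)%N -> v%:E < alpha P l x ->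
  sliced k v x = sliced l v x.
Proof.
elim: k => [|k IH]; first by rewrite leqn0 => /eqP ->.
rewrite leq_eqVlt => /predU1P[->//|]; rewrite ltnS => lk vl /=.
by rewrite (lt_le_trans vl (alpha_mono x lk)) IH.
Qed.

Lemma update_prefix p l k v x : (l <= k)%N -> v%:E < alpha P l x ->
  update p k v x = sliced l v x.
Proof.
move=> lk vl; rewrite /update (lt_le_trans vl (alpha_mono x lk)).
exact: sliced_prefix.
Qed.

Lemma sliced_same l v x y : same_first l x y -> sliced l v x = sliced l v y.
Proof.
elim: l => [|l IH] xy /=.
  by congr quantile; apply/funext => a; exact: alpha_letter_same.
have xy' : same_first l x y by move=> i il; apply: xy; exact: ltnW.
rewrite IH// (alpha_same xy'); case: ifP => // _.
by congr quantile; apply/funext => a;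
  rewrite (alpha_letter_same _ xy) (alpha_letter_same _ xy').
Qed.

Lemma update_same p k v x y : same_first k x y ->
  (forall a, p a x = p a y) -> update p k v x = update p k v y.
Proof.
move=> xy pxy; rewrite /update (sliced_same _ xy) (alpha_same xy).
case: ifP => // _; congr quantile; apply/funext => a.
by rewrite (alpha_letter_same _ xy) pxy.
Qed.

Lemma interval0E a v : interval0 P a v =
  (below (alpha0_letter P) a <= v%:E < upto (alpha0_letter P) a).
Proof. by []. Qed.

Lemma interval0_lt a v : interval0 P a v -> v%:E < alpha0 P.
Proof.
by move=> /andP[_ h]; apply: lt_le_trans h _; exact: (upto_le (alpha0_letter P)).
Qed.

Lemma update_interval0 p k a v x : interval0 P a v -> update p k v x = a.
Proof.
move=> vI; rewrite (@update_prefix _ 0) ?alpha0E ?(interval0_lt vI)//=.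
rewrite sube0 -(@quantileE _ _ _ _ _ vI); congr quantile.
by apply/funext => b; exact: alpha_letter0.
Qed.

Lemma interval0_inj a b v : interval0 P a v -> interval0 P b v -> a = b.
Proof. exact: quantile_inj. Qed.

Lemma measurable_lt_cst (c : \bar R) : measurable [set v : R | v%:E < c].
Proof.
have -> : [set v : R | v%:E < c] = setT `&` EFin @^-1` [set` `]-oo, c[].
  by apply/seteqP; split => v /=; rewrite in_itv/=; tauto.
exact: EFin_measurable measurableT _ (emeasurable_itv _).
Qed.

Lemma measurable_sliced l x a : measurable [set v : R | sliced l v x = a].
Proof.
elim: l => [|l IH] /=.
  exact: (measurable_quantile (fun b => alpha_letter P 0 b x) 0).
rewrite (_ : mkset _ =
    ([set v : R | v%:E < alpha P l x] `&` [set v | sliced l v x = a]) `|`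
    (~` [set v : R | v%:E < alpha P l x] `&` [set v : R |
      quantile (fun a => alpha_letter P l.+1 a x - alpha_letter P l a x)
        (v%:E - alpha P l x) = a])).
  apply: measurableU; apply: measurableI => //.
  - exact: measurable_lt_cst.
  - by apply: measurableC; exact: measurable_lt_cst.
  - exact: measurable_quantile.
apply/seteqP; split => v /=; case: (v%:E < alpha P l x)%E => /=.
- by left.
- by right.
- by move=> [[]|[]].
- by move=> [[]|[]].
Qed.

Lemma measurable_update p k x a : measurable [set v : R | update p k v x = a].
Proof.
rewrite /update (_ : mkset _ =
    ([set v : R | v%:E < alpha P k x] `&` [set v | sliced k v x = a]) `|`
    (~` [set v : R | v%:E < alpha P k x] `&` [set v : R |
      quantile (fun a => (p a x)%:E - alpha_letter P k a x)
        (v%:E - alpha P k x) = a])).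
  apply: measurableU; apply: measurableI.
  - exact: measurable_lt_cst.
  - exact: measurable_sliced.
  - by apply: measurableC; exact: measurable_lt_cst.
  - exact: measurable_quantile.
apply/seteqP; split => v /=; case: (v%:E < alpha P k x)%E => /=.
- by left.
- by right.
- by move=> [[]|[]].
- by move=> [[]|[]].
Qed.

Lemma measurable_interval0 a : measurable (interval0 P a).
Proof.
have -> : interval0 P a = setT `&` EFin @^-1`
    [set` `[below (alpha0_letter P) a, upto (alpha0_letter P) a[].
  by apply/seteqP; split => v /=; rewrite in_itv/=; tauto.
exact: EFin_measurable measurableT _ (emeasurable_itv _).
Qed.

(** Adds one slice: the draws below [c] contribute at most [r], and those in [[c, W[] at most [w a].
    It serves both for the increments from [alpha_l] to [alpha_(l+1)] and for the last slice, from
    [alpha_k] to 1. *)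
Lemma le_measure_slice (B : set R) (w : A ->
  \bar R) (c W : \bar R) (r : \bar R) a :
  (forall b, 0 <= w b) -> c \is a fin_num -> W = c + \esum_(b in [set: A]) w b ->
  W \is a fin_num -> measurable B ->
  measurable [set v | if v%:E < c then B v else quantile w (v%:E - c) = a] ->
  lebesgue_measure ([set v : R | 0 <= v%:E < c] `&` B) <= r ->
  lebesgue_measure ([set v : R | 0 <= v%:E < W] `&`
    [set v | if v%:E < c then B v else quantile w (v%:E - c) = a]) <= r + w a.
Proof.
move=> w0 cf WE Wf mB mB' Br.
have ewf : \esum_(b in [set: A]) w b \is a fin_num.
  by move: Wf; rewrite WE fin_numD => /andP[].
have mitv (b1 b2 : \bar R) : measurable [set v : R | b1 <= v%:E < b2].
  rewrite (_ : mkset _ = setT `&` EFin @^-1` [set` `[b1, b2[]).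
    exact: EFin_measurable measurableT _ (emeasurable_itv _).
  by apply/seteqP; split => v /=; rewrite in_itv/=; tauto.
have mq := measurable_quantile w c a.
apply: le_trans (leeD Br (le_quantile_measure a w0 cf ewf)).
rewrite -WE.
set S1 := _ `&` B; set S2 := [set v : R | c <= v%:E < W] `&` _.
have mS1 : measurable S1 by exact: measurableI.
have mS2 : measurable S2 by exact: measurableI.
apply: (@le_trans _ _ (lebesgue_measure (S1 `|` S2))); last exact: measureU2.
have mS12 : measurable (S1 `|` S2) by exact: measurableU.
have mS := measurableI _ _ (mitv 0 W) mB'.
apply: le_measure; rewrite ?inE.
- exact: mS.
- exact: mS12.
- move=> v /= [/andP[v0 vW]]; case: ltP => vc h; [left|right].
    by split => //=; rewrite v0 vc.
  by split => //=; rewrite vc vW.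
Qed.

Lemma sliced_measure l x a :
  lebesgue_measure ([set v : R | 0 <= v%:E < alpha P l x] `&`
    [set v | sliced l v x = a]) <= alpha_letter P l a x.
Proof.
elim: l => [|l IH].
  have := @le_quantile_measure _ _ (fun a => alpha_letter P 0 a x) 0 a.
  rewrite add0e; apply => // [b|]; first exact: alpha_letter_ge0.
  exact: alpha_fin.
pose w a := alpha_letter P l.+1 a x - alpha_letter P l a x.
have w0 b : 0 <= w b.
  by rewrite sube_ge0 ?alpha_letter_fin// alpha_letter_mono.
have -> : alpha_letter P l.+1 a x = alpha_letter P l a x + w a.
  by rewrite addeC subeK ?alpha_letter_fin.
have := @le_measure_slice [set v | sliced l v x = a] w (alpha P l x)
  (alpha P l.+1 x) _ a w0 (alpha_fin l x) _ (alpha_fin l.+1 x)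
  (measurable_sliced l x a) _ IH.
have E : [set v : R | if v%:E < alpha P l x then [set v | sliced l v x = a] v
    else quantile w (v%:E - alpha P l x) = a] = [set v | sliced l.+1 v x = a].
  by apply/seteqP; split => v /=; case: ifP.
rewrite E; apply; last exact: measurable_sliced.
rewrite -esumD; [|by move=> *; exact: alpha_letter_ge0|by []].
by apply: eq_esum => b _; rewrite addeC subeK ?alpha_letter_fin.
Qed.

Lemma update_measure (p : A -> past -> R) k x a :
  (forall b, alpha_letter P k b x <= (p b x)%:E) ->
  \esum_(b in [set: A]) (p b x)%:E = 1 ->
  unif [set v | update p k v x = a] <= (p a x)%:E.
Proof.
move=> pP p1; pose w b := (p b x)%:E - alpha_letter P k b x.
have w0 b : 0 <= w b by rewrite sube_ge0 ?alpha_letter_fin.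
have -> : (p a x)%:E = alpha_letter P k a x + w a.
  by rewrite addeC subeK ?alpha_letter_fin.
have := @le_measure_slice [set v | sliced k v x = a] w (alpha P k x)
  1 _ a w0 (alpha_fin k x) _ _ (measurable_sliced k x a) _ (sliced_measure k x a).
have E : [set v : R | if v%:E < alpha P k x then [set v | sliced k v x = a] v
    else quantile w (v%:E - alpha P k x) = a] = [set v | update p k v x = a].
  by apply/seteqP; split => v /=; rewrite /update; case: ifP.
rewrite E setIC /unif => h.
rewrite (_ : `[0%R, 1%R[%classic = [set v : R | 0 <= v%:E < 1]); last first.
  by apply/seteqP; split => v /=; rewrite in_itv/= lee_fin lte_fin.
apply: h => //; last exact: measurable_update.
rewrite -p1 -esumD; [|by move=> *; exact: alpha_letter_ge0|by []].
by apply: eq_esum => b _; rewrite addeC subeK ?alpha_letter_fin.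
Qed.

End update.

(** * Chains following the conditional laws of a stationary chain *)

Lemma esumZl (R : realType) (T : choiceType) (A : set T) (f : T ->
  \bar R) (c : R) :
  (forall i, 0 <= f i)%E -> (0 <= c)%R ->
  (\esum_(i in A) (c%:E * f i) = c%:E * \esum_(i in A) f i)%E.
Proof.
move=> f0; have le_esumZ d (g : T -> \bar R) : (forall i, 0 <= g i)%E ->
  (0 <= d)%R ->
    (\esum_(i in A) (d%:E * g i) <= d%:E * \esum_(i in A) g i)%E.
  move=> g0 d0; apply: ge_ereal_sup => _ [F [finF FA] <-].
  rewrite -ge0_mule_fsumr//; apply: lee_wpmul2l; rewrite ?lee_fin//.
  by apply: ereal_sup_ubound; exists F.
rewrite le_eqVlt => /predU1P[<-|c0].
  by rewrite mul0e; apply: esum1 => i _; rewrite mul0e.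
apply/eqP; rewrite eq_le (le_esumZ _ _ f0 (ltW c0))/=.
have := le_esumZ c^-1 (fun i => (c%:E * f i)%E).
rewrite (@eq_esum _ _ _ _ f) => [h|i _]; last first.
  by rewrite muleA -EFinM mulVf ?gt_eqF// mul1e.
rewrite -lee_pdivlMl//; apply: h; last by rewrite invr_ge0 ltW.
by move=> i; apply: mule_ge0 => //; rewrite lee_fin ltW.
Qed.

Section blocks.
Context {R : realType} {N : alphabet_size}.
Local Notation A := (letter N).
Local Notation past := (past_space N).
Local Notation path := (path_space N).
Local Open Scope ereal_scope.
Implicit Types (mu nu : probability path R) (a : A) (x y : past) (k n : nat).

Lemma measurable_letter_at (i : int) a : measurable [set w : path | w i = a].
Proof. exact: (@measurable_coord_preimage _ _ i [set a]). Qed.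

Lemma measurable_past_of : measurable_fun setT (@past_of N).
Proof.
apply: measurable_fun_cylinders => i B.
exact: (@measurable_coord_preimage _ _ _ B).
Qed.

Lemma measurable_last_block k x : measurable (last_block k x).
Proof.
apply: (@measurable_same_first A _ path (@past_of N)) => i c.
exact: measurable_letter_at.
Qed.

Lemma last_block_same k x y : same_first k x y -> last_block k x = last_block k y.
Proof.
move=> xy; apply/seteqP; split => w h i ik; first by rewrite (h i ik) xy.
by rewrite (h i ik) xy.
Qed.

Lemma last_block_sub k n x : (k <= n)%N -> last_block n x `<=` last_block k x.
Proof. by move=> kn w h i ik; apply: h; exact: leq_trans kn. Qed.

Lemma markov_kernel_same mu k a x y : same_first k x y ->
  markov_kernel mu k a x = markov_kernel mu k a y.
Proof. by move=> xy; rewrite /markov_kernel (last_block_same xy). Qed.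

Lemma esum_letter_measure mu (B : set path) : measurable B ->
  \esum_(a in [set: A]) mu ([set w : path | w 0%R = a] `&` B) = mu B.
Proof.
move=> mB; pose F n := [set w : path | val (w 0%R) = n] `&` B.
have mF n : measurable (F n).
  apply: measurableI => //.
  exact: (@measurable_coord_preimage _ _ 0%R [set a : A | val a = n]).
transitivity (\esum_(n in [set n | is_letter N n]) mu (F n)).
  rewrite (@reindex_esum _ _ _ [set: A] [set n | is_letter N n] val).
    apply: eq_esum => a _; congr (mu _); apply/seteqP; split => w [h Bw];
      split => //=.
      by rewrite h.
    exact: val_inj.
  split => [a _|a b _ _|n nN]; [exact: (valP a)|exact: val_inj|].
  by exists (exist (fun m => is_letter N m) n nN).
rewrite -(@nneseries_esum _ (fun n => mu (F n)))//.
have <- : \bigcup_(n in [set n | is_letter N n]) F n = B.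
  apply/seteqP; split => w; first by case=> n _ [].
  by move=> Bw; exists (val (w 0%R)); [exact: (valP (w 0%R))|split].
rewrite measure_bigcup//; last first.
  apply/trivIsetP => i j _ _ /eqP ij; apply/seteqP; split => // w.
  by move=> [[/= wi _] [/= wj _]]; case: ij; rewrite -wi -wj.
by apply: eq_eseriesl => n; rewrite mem_setE.
Qed.

(** Product form of the conditional probability; for a block of measure 0 both sides vanish. *)
Lemma markov_kernelE mu k a x :
  (markov_kernel mu k a x)%:E * mu (last_block k x) =
  mu ([set w : path | w 0%R = a] `&` last_block k x).
Proof.
have mb := measurable_last_block k x.
have ma : measurable ([set w : path | w 0%R = a] `&` last_block k x).
  by apply: measurableI => //; exact: measurable_letter_at.
have bf : mu (last_block k x) \is a fin_num by rewrite fin_num_measure.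
have af : mu ([set w : path | w 0%R = a] `&` last_block k x) \is a fin_num.
  by rewrite fin_num_measure.
rewrite -[in LHS](fineK bf) -[RHS](fineK af) -EFinM; congr EFin.
rewrite /markov_kernel; have [b0|b0] := eqVneq (fine (mu (last_block k x))) 0%R.
  rewrite b0 mulr0; apply/esym/eqP; rewrite fine_eq0//; apply/eqP.
  apply/eqP; rewrite eq_le measure_ge0 andbT.
  by rewrite -[leRHS]/(0%:E) -b0 fineK// le_measure ?inE.
by rewrite divfK.
Qed.

Lemma markov_kernel_sum1 mu k x : mu (last_block k x) != 0 ->
  \esum_(a in [set: A]) (markov_kernel mu k a x)%:E = 1.
Proof.
move=> b0; have mb := measurable_last_block k x.
have bf : mu (last_block k x) \is a fin_num by rewrite fin_num_measure.
have bp : (0 < fine (mu (last_block k x)))%R.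
  by rewrite fine_gt0// lt0e b0 measure_ge0/= -ge0_fin_numE.
have := esum_letter_measure mu mb.
rewrite (@eq_esum _ _ _ _ (fun a => (fine (mu (last_block k x)))%:E *
  (markov_kernel mu k a x)%:E)); last first.
  by move=> a _; rewrite fineK// muleC markov_kernelE.
rewrite esumZl//; last 2 first.
- by move=> a; rewrite lee_fin divr_ge0 ?fine_ge0 ?measure_ge0.
- exact: ltW.
rewrite fineK// => h; apply/eqP; rewrite eq_le.
rewrite -(@lee_pmul2l _ (mu (last_block k x)))// ?h ?mule1 ?lexx/=; last first.
  by rewrite lt0e b0 measure_ge0.
rewrite -(@lee_pmul2l _ (mu (last_block k x)))// ?h ?mule1 ?lexx//.
by rewrite lt0e b0 measure_ge0.
Qed.

(** By compatibility, the conditional probability given a string is an average of [P a] over pasts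
    ending with that string, and each of these values is at least [alpha_letter]. This makes the
    last slice of [update] a family of nonnegative weights. *)
Lemma alpha_letter_le_markov P mu k a x : is_kernel P -> compatible mu P ->
  mu (last_block k x) != 0 ->
  alpha_letter P k a x <= (markov_kernel mu k a x)%:E.
Proof.
move=> hP cP b0; have mb := measurable_last_block k x.
have bf : mu (last_block k x) \is a fin_num by rewrite fin_num_measure.
have bp : 0 < mu (last_block k x) by rewrite lt0e b0 measure_ge0.
rewrite -(@lee_pmul2r _ (mu (last_block k x)))// markov_kernelE.
have mB : measurable [set y : past | same_first k x y].
  apply: (@measurable_same_first A _ past id) => i c.
  exact: (@measurable_coord_preimage nat A i [set c]).
have := cP a _ mB; rewrite -[past_of @^-1` _]/(last_block k x) => ->.
rewrite -integral_cst//; apply: ge0_le_integral => //.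
- by move=> *; exact: alpha_letter_ge0.
- apply/measurable_EFinP; apply: measurable_funTS.
  have mp : measurable_fun setT (fun w : path => (a, past_of w) : A * past).
    by apply/measurable_fun_pairP; split => /=;
      [exact: measurable_cst|exact: measurable_past_of].
  exact: measurableT_comp (kernel_measurable hP) mp.
- by move=> w wb; apply: alpha_letter_le.
Qed.

End blocks.

(** * Stationarity and step-by-step transition probabilities *)

Section stationarity.
Context {R : realType} {N : alphabet_size}.
Local Notation A := (letter N).
Local Notation past := (past_space N).
Local Notation path := (path_space N).
Local Open Scope ereal_scope.
Implicit Types (mu nu : probability path R) (a : A) (x y : past) (k n : nat).

Lemma measurable_path_shift j : measurable_fun setT (translate j : path -> path).
Proof.
apply: measurable_fun_cylinders => i B.
exact: (@measurable_coord_preimage _ _ _ B).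
Qed.

Lemma measurable_path_shift_preimage j (B : set path) :
  measurable B -> measurable (translate j @^-1` B : set path).
Proof. by move=> mB; rewrite -[X in measurable X]setTI;
  exact: measurable_path_shift. Qed.

Lemma stationary_shift nu j (B : set path) : stationary nu -> measurable B ->
  nu (translate j @^-1` B) = nu B.
Proof.
move=> st; have pos n (C : set path) : measurable C ->
  nu (translate n%:Z @^-1` C) = nu C.
  move=> mC; elim: n => [|n IH].
    by congr (nu _); apply/seteqP; split => w; rewrite /= /translate;
      under eq_fun do rewrite addr0.
  rewrite -IH -[RHS]st; last exact: measurable_path_shift_preimage.
  have -> : translate n.+1%:Z = translate n%:Z \o @time_shift N.
    apply/funext => w; apply/funext => i.
    by rewrite /translate /time_shift /=; congr (w _); lia.
  by [].
move=> mB; case: j => n; first exact: pos.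
rewrite -(pos n.+1 (translate (Negz n) @^-1` B));
  last exact: measurable_path_shift_preimage.
congr (nu _); apply/seteqP; split => w;
  rewrite /= translate_translate NegzE addNr;
  by have -> : translate 0 w = w by apply/funext => i; rewrite /translate addr0.
Qed.

Lemma last_blockS nu n x : stationary nu ->
  nu (last_block n.+1 x) =
  nu ([set w : path | w 0%R = x 0%N] `&` last_block n (fun i => x i.+1)).
Proof.
move=> st; rewrite -(@stationary_shift _ 1%R _ st);
  last exact: measurable_last_block.
congr (nu _); apply/seteqP; split => w /=.
  move=> h; split; first exact: (h 0%N isT).
  move=> i iN; rewrite -(h i.+1)// /past_of /translate; congr (w _); lia.
move=> [w0 h] [_|i iN]; first exact: w0.
rewrite -(h i)// /past_of /translate; congr (w _); lia.
Qed.

Lemma canonical_last_block k mu nu L x : stationary mu ->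
  canonical_markov k mu nu -> (L <= k)%N ->
  nu (last_block L x) = mu (last_block L x).
Proof.
move=> st [stn _ blk] Lk.
have mb := measurable_last_block L x.
rewrite -(@stationary_shift nu k.+1%:Z _ stn mb) -(@stationary_shift mu k.+1%:Z
  _ st mb).
(* The shift by [k + 1] carries the times [-L, ..., -1] into [1, ..., k]: the entry [x i], at time
   [-(i+1)], is read at time [k - i], that is at the index [k - i.+1] of [block1]. *)
suff -> : translate k.+1%:Z @^-1` last_block L x = @block1 N k @^-1`
  [set y | forall j : 'I_k, (k - j.+1 < L)%N ->
    y j = x (k - j.+1)%N] by exact: blk.
apply/seteqP; split => w /= h.
  move=> j jL; have jk := ltn_ord j.
  by rewrite -(h _ jL) /block1 /past_of /translate; congr (w _); lia.
move=> i iL; have ik : (k - i.+1 < k)%N by lia.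
have e : (k - (k - i.+1).+1 = i)%N by lia.
have := h (Ordinal ik); rewrite /= e => <-//.
by rewrite /block1 /past_of /translate /=; congr (w _); lia.
Qed.

(* [nu] is the chain whose transition at the [n]-th step after a start from an
   empty past uses the last [D n] letters, with the probabilities of [mu]. *)
Record follows mu (D : nat -> nat) nu : Prop := Follows {
  follows_le : forall n, (D n <= n)%N ;
  follows_stationary : stationary nu ;
  follows_block : forall n x, nu (last_block (D n) x) = mu (last_block (D n) x) ;
  follows_step : forall n a x,
    nu ([set w : path | w 0%R = a] `&` last_block n x) =
    (markov_kernel mu (D n) a x)%:E * nu (last_block n x) }.

Lemma follows_id mu : stationary mu -> follows mu id mu.
Proof. by move=> st; split => // n a x; rewrite markov_kernelE. Qed.

(** From step [k] on this is compatibility with the [k]-step kernel. Before that, the string and its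
    next letter have total length at most [k], and such strings have the same law under [nu] and
    [mu]. *)
Lemma follows_canonical k mu nu : stationary mu -> canonical_markov k mu nu ->
  follows mu (minn k) nu.
Proof.
move=> st cm; have [stn cn _] := cm; split => //.
- by move=> n; exact: geq_minr.
- by move=> n x; apply: canonical_last_block cm (geq_minl _ _).
move=> n a x; have [kn|nk] := leqP k n.
  have mb := measurable_last_block n x.
  have mB : measurable [set y : past | same_first n x y].
    apply: (@measurable_same_first A _ past id) => i c.
    exact: (@measurable_coord_preimage nat A i [set c]).
  have := cn a _ mB; rewrite -[past_of @^-1` _]/(last_block n x) => ->.
  rewrite -integral_cst//; apply: eq_integral => w; rewrite inE => wb.
  congr EFin; apply: markov_kernel_same => i ik.
  by apply/esym; apply: wb; exact: leq_trans kn.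
pose y : past := fun i => if i is j.+1 then x j else a.
have := last_blockS n y stn; rewrite /y/= => <-.
have -> : nu (last_block n x) = mu (last_block n x).
  by apply: canonical_last_block cm _ => //; exact: ltnW.
rewrite markov_kernelE (canonical_last_block _ st cm)//.
exact: (last_blockS n y st).
Qed.

End stationarity.

(** * Chains started at a finite time *)

Section history.
Context {R : realType} {N : alphabet_size}.
Local Notation A := (letter N).
Local Notation past := (past_space N).
Local Notation path := (path_space N).
Local Open Scope ereal_scope.
Context (P : A -> past -> R) (hP : is_kernel P) (mu : probability path R).
Implicit Types (a : A) (x y : past) (k n : nat) (D : nat -> nat) (M : int).

Definition step k (v : R) x : A := update P (markov_kernel mu k) k v x.

(* The past seen at time [M + n] by the chain started at time [M] with an
   arbitrary past and driven by [u]. *)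
Fixpoint hist D (u : int -> R) M n : past :=
  if n is m.+1 then
    fun i => if i is j.+1 then hist D u M m j
             else step (D m) (u (M + m%:Z)%R) (hist D u M m)
  else fun=> point.

Lemma step_same k v x y : same_first k x y -> step k v x = step k v y.
Proof.
by move=> xy; apply: update_same => // a; exact: markov_kernel_same.
Qed.

Lemma hist_nth D u M n i : (i < n)%N ->
  hist D u M n i = hist D u M (n - i) 0%N.
Proof.
elim: n i => [|n IH] [|i]//=; rewrite ?subn0// ltnS subSS => iN.
by rewrite IH.
Qed.

Lemma hist_translate D u j M n : hist D (translate j u) M n = hist D u
  (M + j)%R n.
Proof.
elim: n => //= n ->; apply/funext => -[|i]//.
by congr step; rewrite /translate; congr (u _); lia.
Qed.

Lemma hist_noise_eq D u v M n :
  (forall i : int, (M <= i < M + n%:Z)%R -> u i = v i) ->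
  hist D u M n = hist D v M n.
Proof.
elim: n => //= n IH uv; rewrite IH; last by move=> i iM; apply: uv; lia.
by apply/funext => -[|i]//; rewrite uv//; lia.
Qed.

Lemma same_firstS n x y : same_first n.+1 x y <->
  y 0%N = x 0%N /\ same_first n (fun i => x i.+1) (fun i => y i.+1).
Proof.
split => [h|[h0 h] [|i]//]; last exact: h.
by split=> [|i iN]; [exact: h|exact: h].
Qed.

(** Since [D n <= n], the random history can be replaced by the fixed string in the last update. The
    event then splits into one on the draws before time [M + n] and one on the draw at [M + n]
    alone. *)
Lemma hist_same_firstE D M n x : (D n <= n)%N ->
  [set u : noise R | same_first n.+1 x (hist D u M n.+1)] =
  [set u | same_first n (fun i => x i.+1) (hist D u M n)] `&`
  [set u | step (D n) (u (M + n%:Z)%R) (fun i => x i.+1) = x 0%N].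
Proof.
move=> Dn; apply/seteqP; split => u /=.
  move=> /same_firstS[/= h0 h]; split; first exact: h.
  rewrite -h0; apply: step_same => i iD; rewrite -h//; exact: leq_trans Dn.
move=> [h h0]; apply/same_firstS; split => //=; rewrite -h0; apply/esym/step_same.
by move=> i iD; apply: h; exact: leq_trans Dn.
Qed.

Lemma measurable_step k x a i : measurable [set u : noise R | step k (u i) x = a].
Proof.
have := @measurable_coord R i measurableT _
  (measurable_update P (markov_kernel mu k) k x a).
by rewrite setTI.
Qed.

Lemma measurable_hist_same D M n x : (forall n, (D n <= n)%N) ->
  measurable [set u : noise R | same_first n x (hist D u M n)].
Proof.
move=> DD; elim: n x => [|n IH] x.
  by rewrite (_ : mkset _ = setT)//; apply/seteqP; split.
rewrite hist_same_firstE//; apply: measurableI; first exact: IH.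
exact: measurable_step.
Qed.

Lemma measurable_hist D M n i a : (forall n, (D n <= n)%N) ->
  measurable [set u : noise R | hist D u M n i = a].
Proof.
move=> DD; have [iN|nI] := ltnP i n; last first.
  have E u : hist D u M n i = point.
    elim: n i nI => //= n IH [|i]//; rewrite ltnS; exact: IH.
  have [->|ap] := eqVneq a point.
    by rewrite (_ : mkset _ = setT)//; apply/seteqP; split => // u _; exact: E.
  rewrite (_ : mkset _ = set0)//; apply/seteqP; split => // u /=.
  by rewrite E => pa; rewrite pa eqxx in ap.
elim: n i iN => // n IH [_|i iN] /=; last exact: IH.
(* The new letter depends on the earlier draws only through the last [n] letters, so the event is a
   countable union over strings of length [n]. *)
pose F (t : n.-tuple A) : set (noise R) :=
  [set u | same_first n (nth point t) (hist D u M n)] `&`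
  [set u | step (D n) (u (M + n%:Z)%R) (nth point t) = a].
rewrite (_ : mkset _ = \bigcup_(k in [set: nat])
  (if @pickle_inv (n.-tuple A) k is Some t then F t else set0)).
  apply: bigcup_measurable => k _; case: pickle_inv => // t.
  by apply: measurableI; [exact: measurable_hist_same|exact: measurable_step].
apply/seteqP; split => u /=.
  move=> h; pose t := [tuple hist D u M n i | i < n].
  have ht : same_first n (nth point t) (hist D u M n).
    exact: (@same_first_string A point _ (fun u => hist D u M n) n u).
  exists (pickle t) => //; rewrite pickleK_inv; split => //=; rewrite -h.
  by apply: step_same => j jD; apply: ht; exact: leq_trans (DD n).
move=> [k _]; case: pickle_inv => // t [/= ht <-]; apply/esym/step_same => j jD.
by apply: ht; exact: leq_trans (DD n).
Qed.

Context (cP : compatible mu P) (lam : probability (noise R) R)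
  (lamE : iid_noise lam).

(** Induction on [n]: the new draw is independent of the earlier ones, and by [update_measure] it
    produces the required letter with at most the transition probability of [nu]. *)
Lemma hist_law D nu M n x : follows mu D nu ->
  lam [set u | same_first n x (hist D u M n)] <= nu (last_block n x).
Proof.
move=> F; have DD := follows_le F; elim: n x => [|n IH] x.
  rewrite (_ : last_block 0 x = setT) ?probability_setT ?probability_le1//.
    by rewrite (_ : mkset _ = setT)//; apply/seteqP; split.
  by apply/seteqP; split.
rewrite hist_same_firstE// (last_blockS _ _ (follows_stationary F)).
set x' : past := fun i => x i.+1.
rewrite (iid_indep lamE (I := fun i => i < M + n%:Z)%R); last 4 first.
- exact: measurable_hist_same.
- exact: measurable_step.
- by move=> u v uv; rewrite /= (@hist_noise_eq _ u v)// => i /andP[_]; exact: uv.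
- by move=> u v uv /=; rewrite uv// ltxx.
rewrite (follows_step F) muleC.
have mh := measurable_hist_same M n x' DD.
(* For a string of [mu]-probability 0, [markov_kernel] is not a probability vector; but the
   induction hypothesis then says that the history almost surely does not end with this string. *)
have [b0|b0] := eqVneq (mu (last_block (D n) x')) 0.
  have -> : lam [set u | same_first n x' (hist D u M n)] = 0.
    apply/eqP; rewrite eq_le measure_ge0 andbT (le_trans (IH x'))//.
    rewrite -b0 -(follows_block F); apply: le_measure; rewrite ?inE;
      by [exact: measurable_last_block|exact: last_block_sub].
  rewrite mule0; apply: mule_ge0; last exact: measure_ge0.
  by rewrite lee_fin divr_ge0// fine_ge0 ?measure_ge0.
apply: lee_pmul; [exact: measure_ge0|exact: measure_ge0| |exact: IH].
rewrite (iid_coord lamE _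
  (measurable_update P (markov_kernel mu (D n)) (D n) x' (x 0%N))).
apply: update_measure => // [b|]; first exact: alpha_letter_le_markov.
exact: markov_kernel_sum1.
Qed.

(* The second chain starts [r] steps later than the first one. *)
Lemma hist_agree D1 D2 u M r n :
  (forall n, (D2 n <= n)%N) ->
  (forall i, (i < n)%N ->
     D1 (r + i)%N = D2 i \/
     exists l, [/\ (l <= D1 (r + i))%N, (l <= D2 i)%N &
       forall x, same_first i x (hist D2 u (M + r%:Z) i) ->
         (u (M + (r + i)%:Z)%R)%:E < alpha P l x]) ->
  same_first n (hist D2 u (M + r%:Z) n) (hist D1 u M (r + n)).
Proof.
move=> DD; elim: n => // n IH h; have {}IH := IH (fun i iN => h i (ltnW iN)).
rewrite addnS; apply/same_firstS; split => //=.
rewrite PoszD addrA.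
case: (h n (ltnSn n)) => [->|[l [l1 l2 ul]]].
  by apply/esym/step_same => i iD; apply: IH; exact: leq_trans (DD n).
have ln : (l <= n)%N by exact: leq_trans (DD n).
rewrite PoszD addrA in ul.
(* Both updates reduce to the slices of depth [l], which only read letters on which the two
   histories agree by induction. *)
rewrite /step (@update_prefix _ _ P _ l)//; last first.
  rewrite -(@alpha_same _ _ _ l (hist D2 u (M + r%:Z) n)); first exact: ul.
  by move=> i il; apply: IH; exact: leq_trans ln.
rewrite (@update_prefix _ _ P _ l)//; last exact: ul.
by apply/esym/sliced_same => i il; apply: IH; exact: leq_trans ln.
Qed.

(** A draw in [interval0 P a] yields [a] whatever the past and the depth, so the histories obey all
    the constraints defining [J], for every [D]. *)
Lemma hist_J D u M n l : (l <= n)%N ->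
  J P l (translate (M + n%:Z)%R u) (hist D u M n).
Proof.
move=> ln i a il; rewrite /translate hist_nth; last exact: leq_trans ln.
case E : (n - i)%N => [|m]; first lia.
rewrite /= => ua; apply: update_interval0 => //.
by move: ua; congr interval0; congr (u _); lia.
Qed.

End history.

(** * Late draws and regeneration *)

Section late.
Context {R : realType} {N : alphabet_size}.
Local Notation A := (letter N).
Local Notation past := (past_space N).
Local Open Scope ereal_scope.
Context (P : A -> past -> R) (hP : is_kernel P).
Implicit Types (a : A) (x y : past) (k n l m : nat) (u v : int -> R).

Lemma A_inf_le u k x : J P k u x -> A_inf P k u <= alpha P k x.
Proof.
case: k => [_|k Jx] /=; first by rewrite alpha0E.
by apply: ereal_inf_lbound; exists x.
Qed.

Lemma A_inf_ge u k (c : \bar R) : (forall x, J P k u x -> c <= alpha P k x) ->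
  c <= A_inf P k u.
Proof.
case: k => [h|k h] /=; last by apply: le_ereal_inf_tmp => _ [x Jx <-]; exact: h.
by rewrite -(alpha0E P point); apply: h => i a; rewrite ltn0.
Qed.

Lemma J_antimono k l u : (k <= l)%N -> J P l u `<=` J P k u.
Proof. by move=> kl x Jx i a ik; apply: Jx; exact: leq_trans kl. Qed.

Lemma A_inf_mono k l u : (k <= l)%N -> A_inf P k u <= A_inf P l u.
Proof.
move=> kl; apply: A_inf_ge => x /(J_antimono kl) /A_inf_le/le_trans; apply.
exact: alpha_mono.
Qed.

(** The intervals are disjoint, so the constraints do not conflict; hence the infimum in [A_inf] is
    over a nonempty set and stays at most 1. *)
Lemma J_nonempty k u : exists x, J P k u x.
Proof.
exists (fun i => xget point [set a | interval0 P a (u (- (i.+1)%:Z)%R)]) =>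
  i a _ h.
by apply: xget_unique => // b hb; exact: (interval0_inj hb h).
Qed.

Lemma A_inf_le1 k u : A_inf P k u <= 1.
Proof.
have [x /A_inf_le/le_trans] := J_nonempty k u; apply; exact: alpha_le1.
Qed.

Lemma A_inf_ge0 k u : 0 <= A_inf P k u.
Proof. by apply: A_inf_ge => x _; exact: alpha_ge0. Qed.

Lemma A_inf_monoJ k u v : J P k v `<=` J P k u -> A_inf P k u <= A_inf P k v.
Proof. by move=> vu; apply: A_inf_ge => x /vu /A_inf_le. Qed.

Lemma A_inf_eq k u v :
  (forall i, (i < k)%N -> u (- (i.+1)%:Z)%R = v (- (i.+1)%:Z)%R) ->
  A_inf P k u = A_inf P k v.
Proof.
move=> uv; apply/eqP; rewrite eq_le !A_inf_monoJ// => x Jx i a ik h;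
  apply: Jx => //.
  by rewrite uv.
by rewrite -uv.
Qed.

(** [J] depends on a draw only through the letter that it determines, if any. Coding each draw by an
    element of the countable type [option A] makes [A_inf P k] a function of a string of length [k],
    which gives its measurability. *)
Let coded (o : option A) : set R :=
  if o is Some a then interval0 P a else ~` \bigcup_(n in [set: nat])
    (if @pickle_inv A n is Some a then interval0 P a else set0).

Let coded_None (t : R) : coded None t <-> forall a, ~ interval0 P a t.
Proof.
split=> [h a va|h [n _]]; last by case: pickle_inv => // a; exact: h.
by apply: h; exists (pickle a) => //; rewrite pickleK_inv.
Qed.

Let code (t : R) : option A := xget None [set o | coded o t].

Let measurable_code (i : int) o : measurable [set u : noise R | code (u i) = o].
Proof.
have mc : measurable [set t : R | code t = o].
  apply: measurable_xget => [[a|]|v [a|] [b|]].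
  - exact: measurable_interval0.
  - apply: measurableC; apply: bigcup_measurable => n _.
    by case: pickle_inv => // a; exact: measurable_interval0.
  - by move=> h1 h2; rewrite (interval0_inj h1 h2).
  - by move=> h1 /coded_None/(_ a).
  - by move=> /coded_None/(_ b).
  - by [].
by have := @measurable_coord R i measurableT _ mc; rewrite setTI.
Qed.

Let codeP (t : R) a : code t = Some a <-> interval0 P a t.
Proof.
split=> [|h]; rewrite /code.
  by case: xgetP => // o _ h oa; rewrite oa in h.
apply: xget_unique => // -[b|] h'; first by rewrite (interval0_inj h h').
by have /coded_None/(_ a) := h'.
Qed.

Let Jcode k (y : nat -> option A) : set past :=
  [set x | forall i a, (i < k)%N -> y i = Some a -> x i = a].

Let JcodeE k u : J P k u = Jcode k (fun i => code (u (- (i.+1)%:Z)%R)).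
Proof.
by apply/seteqP; split => x h i a ik /codeP; exact: h.
Qed.

Lemma measurable_A_inf k : measurable_fun setT (fun u : noise R => A_inf P k u).
Proof.
case: k => [|k]; first exact: measurable_cst.
move=> _ B mB; rewrite setTI.
pose S (y : nat -> option A) :=
  B (ereal_inf [set alpha P k.+1 x | x in Jcode k.+1 y]).
rewrite (_ : _ @^-1` _ = [set u : noise R | S (fun i =>
  code (u (- (i.+1)%:Z)%R))]); last first.
  by apply/seteqP; split => u /=; rewrite /S JcodeE.
apply: (@measurable_depends_on_first _ None _ _ _ _ k.+1 S).
  by move=> i o; exact: measurable_code.
move=> y y' yy'; rewrite /S; suff <- : Jcode k.+1 y = Jcode k.+1 y' by [].
by apply/seteqP; split => x Jx i a ik E; apply: Jx => //; rewrite -E ?yy'.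
Qed.

(* The event [ell > k], translated to time [j]. *)
Definition late k (j : int) : set (noise R) :=
  [set u | A_inf P k (translate j u) <= (u j)%:E].

Lemma measurable_late k j : measurable (late k j).
Proof.
have m1 : measurable_fun setT (fun u : noise R => A_inf P k (translate j u)).
  exact: (measurableT_comp (measurable_A_inf k) (@measurable_translate R j)).
have m2 : measurable_fun setT (fun u : noise R => (u j)%:E).
  by apply/measurable_EFinP; exact: measurable_coord.
by have := emeasurable_fun_le measurableT m1 m2; rewrite setTI.
Qed.

Lemma late_translate k i j u : late k i (translate j u) <-> late k (i + j)%R u.
Proof. by rewrite /late /= translate_translate. Qed.

Lemma late_eq k j u v : (forall i : int, (j - k%:Z <= i <= j)%R -> u i = v i) ->
  late k j u -> late k j v.
Proof.
move=> uv; rewrite /late /= -uv; last lia.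
rewrite (@A_inf_eq _ _ (translate j v))// => i ik.
by rewrite /translate uv//; lia.
Qed.

(** [A_inf P j u] is nondecreasing in [j], so a draw at least [A_k] is at least every [A_j] with
    [j <= k]. *)
Lemma ell_lateE k : [set u : int -> R | k%:R%:E < ell P u] = late k 0.
Proof.
have t0 u : translate 0 u = u by apply/funext => i; rewrite /translate addr0.
apply/seteqP; split => u; rewrite /late /= t0.
  move=> kl; rewrite leNgt; apply/negP => h.
  have : ell P u <= k%:R%:E by apply: ereal_inf_lbound; exists k.
  by rewrite leNgt kl.
move=> h; apply: (@lt_le_trans _ _ (k.+1%:R%:E));
  first by rewrite lte_fin ltr_nat.
apply: le_ereal_inf_tmp => _ [j /= uj <-]; rewrite lee_fin ler_nat ltnNge.
by apply/negP => /A_inf_mono jk; have := lt_le_trans uj (le_trans (jk u) h);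
  rewrite ltxx.
Qed.

(* No start in ]-n, 0] lets the chain run up to time [0] independently of the
   past before it. *)
Definition stuck n : set (noise R) :=
  [set u | forall m, (m < n)%N ->
     exists2 j, (j <= m)%N & late (m - j) (- j%:Z)%R u].

(* From time [0] on, no draw ever looks before time [0]. *)
Definition regenerates : set (noise R) := [set u | forall n, ~ late n n%:Z u].

Lemma measurable_stuck n : measurable (stuck n).
Proof.
rewrite (_ : stuck n = \bigcap_(m in `I_n) \bigcup_(j in `I_m.+1) late (m - j)
  (- j%:Z)%R).
  apply: fin_bigcap_measurable => // m _; apply: bigcup_measurable => j _.
  exact: measurable_late.
by apply/seteqP; split.
Qed.

Lemma measurable_regenerates : measurable regenerates.
Proof.
rewrite (_ : regenerates = \bigcap_(n in [set: nat]) ~` late n n%:Z).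
  by apply: bigcap_measurable => // n _; apply: measurableC;
    exact: measurable_late.
by apply/seteqP; split => u h; [move=> n _; exact: h|move=> n; exact: (h n I)].
Qed.

Lemma stuck_eq n u v : (forall i : int, (- n%:Z < i)%R -> u i = v i) ->
  stuck n u -> stuck n v.
Proof.
move=> uv h m mn; have [j jm lj] := h m mn; exists j => //.
by apply: late_eq lj => i ij; apply: uv; lia.
Qed.

Context (lam : probability (noise R) R) (lamE : iid_noise lam).

(** The first event is decided by the draws up to time [-n], the second by the draws in []-n, 0]]: a
    start at [-m] with [m < n] is tested on the draws in [[-m, 0]]. *)
Lemma late_stuck_indep k n :
  lam (late k (- n%:Z)%R `&` stuck n) = lam (late k 0) * lam (stuck n).
Proof.
rewrite (iid_indep lamE (I := fun i => i <= - n%:Z)%R); last 4 first.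
- exact: measurable_late.
- exact: measurable_stuck.
- by move=> u v uv; apply: late_eq => i ij; apply: uv; lia.
- by move=> u v uv; apply: stuck_eq => i ij; apply: uv; lia.
congr (_ * _); rewrite -(iid_translate lamE (- n%:Z)%R (measurable_late k 0)).
congr (lam _); apply/seteqP; split => u /=.
  by move=> h; apply/late_translate; rewrite add0r.
by move=> /late_translate; rewrite add0r.
Qed.

(** In the original time: no start in []0, n]] is good up to [n], and the start at [n + 1] is good
    forever. *)
Let renewal n : set (noise R) := translate n%:Z @^-1`
  (stuck n `&` translate 1 @^-1` regenerates).

Let measurable_translate_preimage j (S : set (noise R)) : measurable S ->
  measurable (translate j @^-1` S : set (noise R)).
Proof.
by move=> mS; rewrite -[X in measurable X]setTI; exact: measurable_translate.
Qed.

Let renewal_law n : lam (renewal n) = lam (stuck n) * lam regenerates.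
Proof.
have mr := measurable_translate_preimage 1%R measurable_regenerates.
rewrite iid_translate//; last by apply: measurableI => //;
  exact: measurable_stuck.
rewrite (iid_indep lamE (I := fun i => i <= 0)%R)//.
- by rewrite (iid_translate lamE 1%R measurable_regenerates).
- exact: measurable_stuck.
- move=> u v uv h m mn; have [j jm lj] := h m mn; exists j => //.
  by apply: late_eq lj => i ij; apply: uv; lia.
- move=> u v uv h n' /late_translate lv; apply: (h n'); apply/late_translate.
  by apply: late_eq lv => i ij; apply/esym/uv; lia.
Qed.

Let trivIset_renewal : trivIset setT renewal.
Proof.
apply/trivIsetP => i j _ _; wlog ij : i j / (i < j)%N.
  move=> h /[dup] ne; rewrite neq_ltn => /orP[ij|ji]; first exact: h.
  by rewrite setIC h// eq_sym.
move=> _; apply/seteqP; split => // u [[_ ri] [sj _]].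
(* Seen from time [j], the start at [i + 1] is the one at [-(j - i.+1)]. It is good forever by [ri],
   while [sj] makes some draw after it late. *)
have [|l lm /late_translate h] := sj (j - i.+1)%N; first lia.
apply: (ri (j - i.+1 - l)%N); apply/late_translate/late_translate.
by move: h; congr (late _ _ u); lia.
Qed.

(* The events "stuck at [n], then regenerating from [n + 1] on" are disjoint. *)
Lemma sum_stuck_le1 :
  \sum_(n <oo) (lam (stuck n) * lam regenerates) <= 1.
Proof.
have mr n : measurable (renewal n).
  apply: measurable_translate_preimage; apply: measurableI;
    first exact: measurable_stuck.
  exact: measurable_translate_preimage measurable_regenerates.
under eq_eseriesr do rewrite -renewal_law.
rewrite -measure_semi_bigcup//; last exact: bigcup_measurable.
by apply: probability_le1; exact: bigcup_measurable.
Qed.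

End late.

(** * Positivity of the regeneration probability *)

(** The integral of a nonnegative function is a supremum over the simple functions below it, which
    gives monotonicity for arbitrary functions, such as the infinite product [inv_prod]. *)
Lemma ge0_le_integralT d (T : measurableType d) (R : realType)
    (m : {measure set T -> \bar R}) (f g : T -> \bar R) :
  (forall x, 0 <= f x)%E -> (forall x, f x <= g x)%E ->
  (\int[m]_x f x <= \int[m]_x g x)%E.
Proof.
move=> f0 fg; have g0 x : (0 <= g x)%E by exact: le_trans (fg x).
rewrite !ge0_integralTE//; apply: ereal_sup_le => _ [h hf <-].
by exists h => // x; exact: le_trans (fg x).
Qed.

(** * Consequences of the integrability of the infinite product *)

Section summability.
Context {R : realType} {N : alphabet_size}.
Local Notation A := (letter N).
Local Notation past := (past_space N).
Local Open Scope ereal_scope.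
Context (P : A -> past -> R) (hP : is_kernel P).
Implicit Types (a : A) (x y : past) (k n l m : nat) (u v : int -> R).

(** This is [(c - 1)^2 >= 0] divided by [c]; at [c = 0] the inverse is [+oo]. *)
Lemma inve_ge_1B (c : \bar R) : 0 <= c -> c <= 1 -> 1 + (1 - c) <= c^-1.
Proof.
move=> c0 c1; have cf : c \is a fin_num by rewrite ge0_fin_numE//
  (le_lt_trans c1)// ltry.
rewrite -(fineK cf) in c0 c1 *; move: (fine c) c0 c1 => r;
  rewrite !lee_fin => r0 r1.
rewrite inver; case: eqVneq => [_|rn0]; first by rewrite leey.
have rp : (0 < r)%R by rewrite lt0r rn0.
rewrite -!(EFinB, EFinD) lee_fin -(ler_pM2r rp) mulVf//.
have := sqr_ge0 (r - 1)%R; rewrite expr2; lra.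
Qed.

Lemma inve_ge1 (c : \bar R) : 0 <= c -> c <= 1 -> 1 <= c^-1.
Proof.
move=> c0 c1; apply: le_trans (inve_ge_1B c0 c1).
by rewrite leeDl// sube_ge0// ?ltry//;
  rewrite ge0_fin_numE// (le_lt_trans c1)// ltry.
Qed.

Let prod_ge0 u n : 0 <= \prod_(0 <= k < n) (A_inf P k u)^-1.
Proof. by apply: prode_ge0 => k _; rewrite inve_ge0 A_inf_ge0. Qed.

Lemma prod_le_inv_prod u n : \prod_(0 <= k < n) (A_inf P k u)^-1 <= inv_prod P u.
Proof.
rewrite /inv_prod; set f := (f in limn f).
have /ereal_nondecreasing_cvgn/cvg_lim -> // : nondecreasing_seq f.
  apply/nondecreasing_seqP => m; rewrite /f big_nat_recr//=.
  rewrite -[leLHS]mule1; apply: lee_pmul => //.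
  by apply: inve_ge1; [exact: A_inf_ge0|exact: A_inf_le1].
by apply: ereal_sup_ubound; exists n.
Qed.

(** By induction, [1 + sum (1 - A_k)] is at most the product of the [A_k^-1]: each factor is at
    least [1 + (1 - A_k)], and the cross terms of the expanded product are nonnegative. *)
Lemma sum_le_inv_prod u n : \sum_(0 <= k < n) (1 - A_inf P k u) <= inv_prod P u.
Proof.
apply: le_trans (prod_le_inv_prod u n).
have s0 m : 0 <= \sum_(0 <= k < m) (1 - A_inf P k u).
  apply: sume_ge0 => k _; rewrite sube_ge0 ?A_inf_le1//.
  by rewrite ge0_fin_numE ?A_inf_ge0// (le_lt_trans (A_inf_le1 hP k u))// ltry.
suff : 1 + \sum_(0 <= k < n) (1 - A_inf P k u) <= \prod_(0 <= k < n)
  (A_inf P k u)^-1.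
  by apply: le_trans; rewrite leeDr.
elim: n => [|n IH]; first by rewrite !big_geq// adde0.
rewrite !big_nat_recr//=.
have a0 : 0 <= 1 - A_inf P n u.
  rewrite sube_ge0 ?A_inf_le1//.
  by rewrite ge0_fin_numE ?A_inf_ge0// (le_lt_trans (A_inf_le1 hP n u))// ltry.
apply: (@le_trans _ _ ((1 + \sum_(0 <= k < n) (1 - A_inf P k u)) * (1 +
  (1 - A_inf P n u)))).
  rewrite [leRHS]ge0_muleDr ?mule1// ?adde_ge0//.
  rewrite addeA leeD2l// -[leLHS]mul1e; apply: lee_wpmul2r => //.
  by rewrite leeDl.
apply: lee_pmul; [exact: adde_ge0|exact: adde_ge0|exact: IH|].
by apply: inve_ge_1B; [exact: A_inf_ge0|exact: A_inf_le1].
Qed.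

Lemma unif_ge (c : \bar R) : 0 <= c -> c <= 1 ->
  unif [set v : R | c <= v%:E] = 1 - c.
Proof.
move=> c0 c1; have cf : c \is a fin_num by rewrite ge0_fin_numE//
  (le_lt_trans c1)// ltry.
rewrite -(fineK cf) in c0 c1 *; move: (fine c) c0 c1 => r;
  rewrite !lee_fin => r0 r1.
rewrite /unif (_ : _ `&` _ = `[r, 1%R[%classic).
  rewrite lebesgue_measure_itv/= lte_fin; case: ltgtP r1 => // -> _.
  by rewrite subee.
apply/seteqP; split => v /=; rewrite !in_itv/= lee_fin.
  by move=> [-> /andP[]].
by move=> /andP[rv ->]; rewrite rv (le_trans r0 rv).
Qed.

Context (lam : probability (noise R) R) (lamE : iid_noise lam).

(** [A_inf P k] only reads draws at negative times. Given these, the independent draw at time 0 is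
    at least [A_inf P k u] with probability [1 - A_inf P k u]; integrating over them is Fubini's
    theorem for the resampled noise. *)
Lemma late_law k : lam (late P k 0) = \int[lam]_u (1 - A_inf P k u).
Proof.
rewrite -(iid_mix_noise lamE (fun i => i < 0)%R); last exact: measurable_late.
rewrite /product_measure1; apply: eq_integral => u _ /=.
rewrite -unif_ge ?A_inf_ge0 ?A_inf_le1//.
rewrite -(@iid_coord _ lam lamE 0%R [set v : R | A_inf P k u <= v%:E]);
  last first.
  have -> : [set v : R | A_inf P k u <= v%:E] = ~` [set v : R | v%:E < A_inf P
    k u].
    by apply/seteqP; split => v /=; rewrite leNgt => /negP.
  by apply: measurableC; exact: measurable_lt_cst.
have E v : A_inf P k (translate 0 (mix_noise (fun i : int =>
  (i < 0)%R) (u, v))) = A_inf P k u.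
  apply: A_inf_eq => i ik; rewrite /translate /mix_noise addr0.
  by have -> : (- (i.+1)%:Z < 0)%R by lia.
congr (lam _); apply/seteqP; split => v; rewrite /xsection /= in_setE /late /= E;
  by rewrite /mix_noise ltxx.
Qed.

Lemma summable_late d (Omega : measurableType d) (Pr : probability Omega R)
    (X : {mfun Omega >-> noise R}) :
  (forall S, lam S = distribution Pr X S) ->
  \int[Pr]_w inv_prod P (X w) < +oo -> \sum_(k <oo) lam (late P k 0) < +oo.
Proof.
move=> lamX; apply: le_lt_trans.
apply: lime_le; first by apply: is_cvg_nneseries => *; exact: measure_ge0.
apply: nearW => n.
have a0 k u : 0 <= 1 - A_inf P k u.
  rewrite sube_ge0 ?A_inf_le1//.
  by rewrite ge0_fin_numE ?A_inf_ge0// (le_lt_trans (A_inf_le1 hP k u))// ltry.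
have ma k : measurable_fun setT (fun u : noise R => 1 - A_inf P k u).
  apply: emeasurable_funB; [exact: measurable_cst|exact: measurable_A_inf].
have -> : \sum_(0 <= k < n) lam (late P k 0) =
    \int[Pr]_w \sum_(0 <= k < n) (1 - A_inf P k (X w)).
  rewrite ge0_integral_sum//; last first.
    by move=> k; apply: (measurableT_comp (ma k)).
  apply: eq_bigr => k _; rewrite late_law.
  rewrite -(@ge0_integral_distribution _ _ _ _ _ Pr X (fun u =>
    1 - A_inf P k u))//.
  by apply: eq_measure_integral => S mS _; exact: lamX.
apply: ge0_le_integralT => w; first by apply: sume_ge0.
exact: sum_le_inv_prod.
Qed.

(** If [alpha0 P] were 0, the first factor of the product would be [+oo] at every point. *)
Lemma alpha0_gt0 d (Omega : measurableType d) (Pr : probability Omega R)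
    (X : Omega -> noise R) :
  \int[Pr]_w inv_prod P (X w) < +oo -> 0 < alpha0 P.
Proof.
move=> h; rewrite lt0e -{2}(alpha0E P point) alpha_ge0// andbT.
apply/eqP => a0; move: h; rewrite ltNge => /negP; apply.
apply: (@le_trans _ _ (\int[Pr]_w (cst +oo w))).
  by rewrite integral_cst//= probability_setT mule1.
apply: ge0_le_integralT => w; first by rewrite /= le0y.
by have := prod_le_inv_prod (X w) 1; rewrite big_nat1 /= a0 inve0.
Qed.

Lemma unif_interval0_gt0 a : 0 < alpha0_letter P a -> 0 < unif (interval0 P a).
Proof.
move=> wa; have w0 b : 0 <= alpha0_letter P b.
  by rewrite -(alpha_letter0 P b point) alpha_letter_ge0.
have up1 : upto (alpha0_letter P) a <= 1.
  apply: le_trans (upto_le _ _) _; rewrite -/(alpha0 P) -(alpha0E P point).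
  exact: alpha_le1.
have upf : upto (alpha0_letter P) a \is a fin_num.
  rewrite ge0_fin_numE; last by apply: esum_ge0.
  by apply: le_lt_trans up1 _; exact: ltry.
have bf : below (alpha0_letter P) a \is a fin_num.
  by move: upf; rewrite uptoE// fin_numD => /andP[].
have b0 := below_ge0 a w0.
have bu : below (alpha0_letter P) a < upto (alpha0_letter P) a.
  by rewrite uptoE// lteDl.
rewrite /unif; have -> : interval0 P a `&` `[0%R, 1%R[%classic =
    `[fine (below (alpha0_letter P) a), fine (upto (alpha0_letter P) a)[%classic.
  apply/seteqP; split => v /=;
    rewrite interval0E !in_itv/= -!lee_fin -!lte_fin !fineK//.
    by case.
  by move=> /[dup] /andP[bv vu] ->; rewrite (le_trans b0 bv) (lt_le_trans vu up1).
rewrite lebesgue_measure_itv/= lte_fin fine_lt//.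
by rewrite -EFinB lte_fin subr_gt0 fine_lt.
Qed.

End summability.

(** * Forcing the first draws below [alpha_0] *)

Section positivity.
Context {R : realType} {N : alphabet_size}.
Local Notation A := (letter N).
Local Notation past := (past_space N).
Local Open Scope ereal_scope.
Context (P : A -> past -> R) (hP : is_kernel P).
Context (lam : probability (noise R) R) (lamE : iid_noise lam).
Hypothesis alpha0P : 0 < alpha0 P.
Hypothesis sum_late : \sum_(k <oo) lam (late P k 0) < +oo.
Implicit Types (a : A) (k n l m : nat) (u v : int -> R).

(** Regeneration at time 0, except that the first [L] draws are not tested. *)
Let punctual L : set (noise R) := [set u | forall n, (L <= n)%N ->
  ~ late P n n%:Z u].

Let measurable_punctual L : measurable (punctual L).
Proof.
rewrite (_ : punctual L = \bigcap_(n in [set n | (L <= n)%N]) ~` late P n n%:Z)//.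
apply: bigcap_measurable => [|n _]; first by exists L => /=.
by apply: measurableC; exact: measurable_late.
Qed.

Let late_translate_law k j : lam (late P k j) = lam (late P k 0).
Proof.
rewrite -(iid_translate lamE j (measurable_late P k 0%R)).
congr (lam _); apply/seteqP; split => u /=.
  by move=> h; apply/late_translate; rewrite add0r.
by move=> /late_translate; rewrite add0r.
Qed.

(** Some tail of the convergent series is less than 1; by the union bound it dominates the
    probability that a draw from time [L] on is late. *)
Let punctual_gt0 : exists L, 0 < lam (punctual L).
Proof.
have := @nneseries_tail_cvg _ (fun k => lam (late P k 0)) xpredT sum_late
  (fun k _ => measure_ge0 _ _).
move=> /fine_cvgP[Hf /cvgrPdist_lt /(_ 1%R ltr01) Hd].
have [L _ /(_ L (leqnn L))[fL dL]] := filterI Hf Hd; exists L.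
set t := (\sum_(L <= k <oo) lam (late P k 0)) in fL dL *.
have t1 : t < 1.
  by rewrite -(fineK fL) lte_fin (le_lt_trans (ler_norm _))// -normrN -sub0r.
have mp := measurable_punctual L.
have : lam (~` punctual L) <= t.
  rewrite /t; under eq_eseriesr => k _ do rewrite -(late_translate_law k k%:Z).
  apply: measure_sigma_subadditive_tail.
  - by move=> n; exact: measurable_late.
  - exact: measurableC.
  - move=> u /existsNP[n /not_implyP[Ln /contrapT un]]; exists n => //=.
    by apply/negP; rewrite -leqNgt.
rewrite probability_setC// => /le_lt_trans /(_ t1) h.
rewrite lt0e measure_ge0 andbT; apply/eqP => p0.
by move: h; rewrite p0 sube0 ltxx.
Qed.

(** Interpolates between [punctual L], for [i = 0], and a part of [regenerates P], for [i = L]: a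
    draw below [alpha_0] is never late. *)
Let forced L i : set (noise R) :=
  punctual L `&` [set u | forall j, (j < i)%N -> (u j%:Z)%:E < alpha0 P].

Let measurable_forced L i : measurable (forced L i).
Proof.
apply: measurableI => //.
rewrite (_ : mkset _ = \bigcap_(j in `I_i) [set u : noise R |
  (u j%:Z)%:E < alpha0 P])//.
apply: fin_bigcap_measurable => // j _.
have := @measurable_coord R j%:Z measurableT _ (measurable_lt_cst (alpha0 P)).
by rewrite setTI.
Qed.

(* Replacing a draw which determines no letter by one which determines the
   letter [a] only shrinks the sets [J], so that no draw becomes late. *)
Let forced_step L i : (i < L)%N -> 0 < lam (forced L i) ->
  0 < lam (forced L i.+1).
Proof.
move=> iL Fi.
have [a wa] : exists a, 0 < alpha0_letter P a.
  apply: contrapT => h; move: alpha0P; rewrite /alpha0 esum1 ?ltxx// => a _.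
  apply/eqP; rewrite eq_le -{2}(alpha_letter0 P a point) alpha_letter_ge0// andbT.
  by rewrite leNgt; apply/negP => ?; apply: h; exists a.
have Ia := unif_interval0_gt0 hP wa.
have [s sa] : exists s, interval0 P a s.
  apply: contrapT => h; move: Ia; rewrite (_ : interval0 P a = set0).
    by rewrite /unif set0I measure0 ltxx.
  by apply/seteqP; split => // s ?; apply: h; exists s.
pose upd u : noise R := fun j => if j == i%:Z then s else u j.
have mupd : measurable_fun setT (upd : noise R -> noise R).
  apply: measurable_fun_noise => j; rewrite /upd; case: eqP => _.
    exact: measurable_cst.
  exact: measurable_coord.
pose G : set (noise R) := upd @^-1` forced L i.+1.
have mG : measurable G.
  by rewrite -[X in measurable X]setTI; apply: mupd.
have mI : measurable [set u : noise R | interval0 P a (u i%:Z)].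
  by have := @measurable_coord R i%:Z measurableT _ (measurable_interval0 P a);
    rewrite setTI.
(* Here the draw at [i] is at least [alpha0 P] and determines no letter. Putting [s] in its place
   adds a constraint to the sets [J], so [A_inf] can only increase. *)
have sub1 : forced L i `\` forced L i.+1 `<=` G.
  move=> u [[pu fu] nF].
  have ui : alpha0 P <= (u i%:Z)%:E.
    rewrite leNgt; apply/negP => ui; apply: nF; split => // j.
    by rewrite ltnS leq_eqVlt => /predU1P[->//|/fu].
  split; last first.
    move=> j ji; rewrite /upd; case: eqP => [_|ne]; first exact: interval0_lt sa.
    by apply: fu; rewrite ltnS leq_eqVlt in ji; case/predU1P: ji ne => // ->.
  move=> n Ln; rewrite /late /= /upd ifF; last by apply/eqP; lia.
  move=> h; apply: (pu n Ln); apply: le_trans h; apply: A_inf_monoJ => //.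
  move=> x Jx l b ln ub; apply: Jx => //; move: ub; rewrite /translate.
  by case: eqP => // -> /interval0_lt; rewrite ltNge ui.
(* Conversely, a draw in [interval0 P a] determines the same letter as [s]. Since [G] ignores the
   draw at [i], this event is independent of [G], and it has positive probability. *)
have sub2 : G `&` [set u | interval0 P a (u i%:Z)] `<=` forced L i.+1.
  move=> u [[pu fu] ui]; split; last first.
    move=> j /fu; rewrite /upd; case: eqP => // -> _; exact: interval0_lt ui.
  move=> n Ln h; apply: (pu n Ln); move: h; rewrite /late /= {2}/upd ifF;
    last by apply/eqP; lia.
  apply: le_trans; apply: A_inf_monoJ => // x Jx l b ln ub; apply: Jx => //.
  move: ub; rewrite /translate /upd; case: eqP => // -> /(interval0_inj sa) <-.
  exact: ui.
have Gp : 0 < lam G -> 0 < lam (forced L i.+1).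
  move=> G0; apply: (@lt_le_trans _ _ (lam (G `&` [set u | interval0 P a
    (u i%:Z)]))).
    rewrite (iid_indep lamE (I := fun j => j != i%:Z))//.
    - rewrite (@iid_coord _ lam lamE i%:Z (interval0 P a));
      last exact: measurable_interval0.
      exact: mule_gt0.
    - by move=> u v uv; rewrite /G /=; suff -> : upd u = upd v by [];
        apply/funext => j; rewrite /upd; case: eqP => // /eqP /uv.
    - by move=> u v uv /=; rewrite uv// negbK.
  apply: le_measure; rewrite ?inE//; exact: measurableI.
(* If [forced L i.+1] were null, all the mass of [forced L i] would lie in the difference, hence in
   [G]. *)
have [//|/negP] := pselect (0 < lam (forced L i.+1)); rewrite -leNgt => F0;
  apply: Gp.
apply: (lt_le_trans Fi); apply: (@le_trans _ _ (lam (forced L i.+1 `|`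
  (forced L i `\` forced L i.+1)))).
  apply: le_measure; rewrite ?inE//.
    by apply: measurableU => //; exact: measurableD.
  by move=> u Fu; have [?|?] := pselect (forced L i.+1 u); [left|right].
apply: (@le_trans _ _ (lam (forced L i.+1) + lam (forced L i `\` forced L i.+1))).
  by apply: measureU2 => //; exact: measurableD.
rewrite -[leRHS]add0e; apply: leeD => //.
by apply: le_measure; rewrite ?inE//; exact: measurableD.
Qed.

Lemma regenerates_gt0 : 0 < lam (regenerates P).
Proof.
have [L pL] := punctual_gt0.
have : 0 < lam (forced L L).
  have : (L <= L)%N by []; elim: {1 4}L => [_|i IH iL].
    suff -> : forced L 0 = punctual L by [].
    by apply/seteqP; split => u; [case|split].
  by apply: forced_step => //; apply: IH; exact: ltnW.
move=> /lt_le_trans; apply; apply: le_measure; rewrite ?inE//.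
  exact: measurable_regenerates.
move=> u [pu fu] n; have [Ln|nL] := leqP L n; first exact: pu.
rewrite /late /= leNgt => /negP; apply; apply: lt_le_trans (fu n nL) _.
exact: (A_inf_mono P (translate n%:Z u) (leq0n n)).
Qed.

End positivity.

(** * The stationary coupling *)

Section path_laws.
Context {R : realType} {N : alphabet_size}.
Local Notation A := (letter N).
Local Notation past := (past_space N).
Local Notation path := (path_space N).
Local Open Scope ereal_scope.

(** Since the alphabet is countable, any event on a finite window is measurable. These events form a
    generating pi-system which is also closed under complements. *)
Definition window_events : set (set path) := [set S | exists n : nat,
  forall w w' : path, (forall i : int, (- n%:Z <= i < n%:Z)%R -> w i = w' i) ->
    S w -> S w'].

(** Places the first [2n] entries of [y] in the window [[-n, n[], the most recent one at time
    [n - 1]; [absz] only matters outside this window. *)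
Let path_of n (y : past) : path := fun i => y (absz (n%:Z - i - 1)%R).

Let window_pastE n (S : set path) :
  (forall w w' : path, (forall i : int, (- n%:Z <= i < n%:Z)%R -> w i = w' i) ->
    S w -> S w') ->
  depends_on_first (n + n) (S \o path_of n) /\
  S = translate n%:Z @^-1` [set w | (S \o path_of n) (past_of w)].
Proof.
move=> dS; split.
  by move=> x y xy; apply: dS => i iN; apply: xy; lia.
apply/seteqP; split => w /=; apply: dS => i iN;
  by rewrite /path_of /past_of /translate; congr (w _); lia.
Qed.

Lemma measurable_past_event L (S : set past) : depends_on_first L S ->
  measurable [set w : path | S (past_of w)].
Proof.
apply: (@measurable_depends_on_first A point _ path (@past_of N)) => i a.
exact: measurable_letter_at.
Qed.

Lemma path_measurableE : @measurable _ path = <<s window_events >>.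
Proof.
apply/seteqP; split.
  apply: smallest_sub; first exact: smallest_sigma_algebra.
  move=> _ [i [B ->]]; apply: sub_sigma_algebra.
  by exists (absz i).+1 => w w' ww' /=; rewrite ww'//; lia.
apply: smallest_sub; first exact: sigma_algebra_measurable.
move=> S [n /window_pastE[dS ->]].
by apply: measurable_path_shift_preimage; exact: measurable_past_event dS.
Qed.

Lemma window_events_setI : setI_closed window_events.
Proof.
move=> S S' [n dS] [n' dS']; exists (maxn n n') => w w' ww' [Sw Sw']; split.
  by apply: dS Sw => i iN; apply: ww'; lia.
by apply: dS' Sw' => i iN; apply: ww'; lia.
Qed.

(** Shifting a window into the past and summing over strings extends the inequality to all window
    events. Applied to the complement it is reversed, so the two probabilities agree on a generating
    pi-system. *)
Lemma stationary_law_unique (m m' : probability path R) :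
  stationary m -> stationary m' ->
  (forall L x, m (last_block L x) <= m' (last_block L x)) ->
  forall B, measurable B -> m B = m' B.
Proof.
move=> st st' mm' B mB.
have le S : window_events S -> m S <= m' S.
  move=> [n /window_pastE[dS ->]]; have mS := measurable_past_event dS.
  rewrite !stationary_shift//.
  apply: (@le_measure_strings A R _ path _ path m m' (@past_of N) (@past_of N)
    point (n + n)) dS => [i a|i a|x]; try exact: measurable_letter_at.
  exact: mm'.
apply: (measure_unique window_events
  (fun=> setT) path_measurableE window_events_setI) => //.
- by move=> _; exists 0%N.
- by rewrite bigcup_const //; exists 0%N.
- move=> S [n dS]; apply/eqP; rewrite eq_le le/=; last by exists n.
  have mS : measurable S by rewrite path_measurableE; apply: sub_sigma_algebra;
    exists n.
  have := le (~` S); rewrite !probability_setC//.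
  have f1 : m S \is a fin_num by rewrite fin_num_measure.
  have f2 : m' S \is a fin_num by rewrite fin_num_measure.
  rewrite -(fineK f1) -(fineK f2) -!EFinB !lee_fin lerD2l lerN2; apply.
  exists n => w w' ww' nS Sw'; apply: nS; apply: dS Sw' => i iN.
  by rewrite ww'.
- by move=> _; rewrite -ge0_fin_numE ?fin_num_measure// measure_ge0.
Qed.

End path_laws.

(** * Limits of the chains as the start recedes, and their coupling *)

Section coupling.
Context {R : realType} {N : alphabet_size}.
Local Notation A := (letter N).
Local Notation past := (past_space N).
Local Notation path := (path_space N).
Local Open Scope ereal_scope.
Context (P : A -> past -> R) (hP : is_kernel P) (mu : probability path R).
Implicit Types (a : A) (x y : past) (k n l m : nat) (D : nat -> nat).
Local Notation hist := (hist P mu).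

(** Limit of the letter at time [j] as the start recedes to [-oo]. A chain started at [j - n] has
    drawn this letter after [n + 1] steps. *)
Definition eventual_letter D (u : int -> R) (j : int) a :=
  exists n0, forall n, (n0 <= n)%N -> hist D u (j - n%:Z)%R n.+1 0%N = a.

Definition coded_path D (u : noise R) : path :=
  fun j => xget point [set a | eventual_letter D u j a].

Lemma eventual_letter_inj D u j a b :
  eventual_letter D u j a -> eventual_letter D u j b -> a = b.
Proof.
move=> [n0 h] [n1 h']; rewrite -(h (maxn n0 n1) (leq_maxl _ _)).
exact: h' (leq_maxr _ _).
Qed.

Lemma coded_pathE D u j a : eventual_letter D u j a -> coded_path D u j = a.
Proof. by move=> h; apply: xget_unique => // b /eventual_letter_inj; apply. Qed.

Lemma coded_path_translate D u i : coded_path D (translate i u) = translate i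
  (coded_path D u).
Proof.
apply/funext => j; rewrite /translate /coded_path; congr xget.
have E n : hist D (translate i u) (j - n%:Z)%R n.+1 = hist D u
  (j + i - n%:Z)%R n.+1.
  by rewrite hist_translate; congr (hist _ _ _ _); lia.
by apply/seteqP; split => a [n0 h]; exists n0 => n /h; rewrite E.
Qed.

Lemma measurable_coded_path D : (forall n, (D n <= n)%N) ->
  measurable_fun setT (coded_path D).
Proof.
move=> DD; apply: measurable_fun_cylinders => j B.
apply: (@measurable_preimage_countable _ _ A (fun u => coded_path D u j)).
apply: (@measurable_xget _ (noise R) A (fun a =>
  [set u | eventual_letter D u j a])).
  move=> a; rewrite (_ : mkset _ = \bigcup_(n0 in [set: nat])
    \bigcap_(n in [set n | (n0 <= n)%N]) [set u : noise R | hist D u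
      (j - n%:Z)%R n.+1 0%N = a]).
    apply: bigcup_measurable => n0 _; apply: bigcap_measurable => [|n _].
      by exists n0 => /=.
    exact: measurable_hist.
  by apply/seteqP; split => u [n0]; exists n0.
by move=> u a b; exact: eventual_letter_inj.
Qed.

(** By [hist_J] the history belongs to the set over which [A_inf] is an infimum, so a draw below
    [A_inf] is below [alpha] at the actual past. *)
Lemma not_late_lt D u M i l x : (l <= i)%N -> ~ late P l (M + i%:Z)%R u ->
  same_first i x (hist D u M i) -> (u (M + i%:Z)%R)%:E < alpha P l x.
Proof.
move=> li /negP; rewrite -ltNge => h xh; apply: (lt_le_trans h).
rewrite (@alpha_same _ _ P l x (hist D u M i)); last first.
  by move=> j jl; apply: xh; exact: leq_trans li.
by apply: A_inf_le; exact: hist_J.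
Qed.

(** Compares, at one time, the depths of two chains started [r] steps apart: they are equal, or both
    cover the [i] letters since the later start. This is the form needed by [hist_agree], with
    [l = i]. *)
Definition coalescent D := forall r i,
  D (r + i)%N = D i \/ ((i <= D (r + i))%N /\ (i <= D i)%N).

(** If no draw in [[-m, 0]] looks before [-m], every chain started earlier agrees from [-m] on with
    the one started there, by [hist_agree]. *)
Lemma not_stuck_hist D u m : (forall n, (D n <= n)%N) -> coalescent D ->
  (forall j, (j <= m)%N -> ~ late P (m - j) (- j%:Z)%R u) ->
  forall n, (m <= n)%N -> hist D u (- n%:Z)%R n.+1 0%N = hist D u
    (- m%:Z)%R m.+1 0%N.
Proof.
move=> DD cD good n mn; pose r := (n - m)%N.
have := @hist_agree _ _ P mu D D u (- n%:Z)%R r m.+1 DD.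
have -> : (- n%:Z + r%:Z = - m%:Z)%R by rewrite /r; lia.
have -> : (r + m.+1 = n.+1)%N by rewrite /r; lia.
apply => // i; rewrite ltnS => im; have [->|[i1 i2]] := cD r i; [by left|right].
exists i; split => // x xh.
have -> : (- n%:Z + (r + i)%N%:Z = - m%:Z + i%:Z)%R by rewrite /r; lia.
apply: (not_late_lt (leqnn i) _ xh).
have := good (m - i)%N (leq_subr _ _).
have -> : (m - (m - i) = i)%N by lia.
by have -> : (- (m - i)%N%:Z = - m%:Z + i%:Z)%R by lia.
Qed.

Lemma not_stuck_eventual D u n : (forall n, (D n <= n)%N) -> coalescent D ->
  ~ stuck P n u -> exists a, eventual_letter D u 0%R a.
Proof.
move=> DD cD /existsNP[m /not_implyP[mn nm]].
have good j : (j <= m)%N -> ~ late P (m - j) (- j%:Z)%R u.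
  by move=> jm lj; apply: nm; exists j.
exists (hist D u (- m%:Z)%R m.+1 0%N), m => i mi; rewrite sub0r.
exact: not_stuck_hist good _ mi.
Qed.

Lemma coalescent_id : coalescent id.
Proof. by move=> r i; right; rewrite leq_addl. Qed.

Lemma coalescent_minn k : coalescent (minn k).
Proof.
move=> r i; have [ki|] := boolP (k <= i)%N; [left|rewrite -ltnNge => ik; right].
  by rewrite !(minn_idPl _)// (leq_trans ki)// leq_addl.
by split; rewrite leq_min ltnW//= leq_addl.
Qed.

(* [- n] is the last time before [0] at which the draw looks further back than
   [k]: a start after [- n] which is good up to [0] would make the chains
     agree. *)
Lemma coded_path_neq k u : (exists n, ~ stuck P n u) ->
  coded_path id u 0%R != coded_path (minn k) u 0%R ->
  exists n, late P k (- n%:Z)%R u /\ stuck P n u.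
Proof.
move=> ex neq; apply: contrapT => none.
have [n nstuck nmin] : exists2 n, ~ stuck P n u & forall j, (j < n)%N ->
  stuck P j u.
  have exb : exists n, `[< ~ stuck P n u >] by case: ex => n ?; exists n;
    apply/asboolP.
  exists (ex_minn exb); case: ex_minnP => n /asboolP // h nmin j jn.
  by apply: contrapT => /asboolP /nmin; rewrite leqNgt jn.
have /existsNP[m /not_implyP[mn nm]] := nstuck.
have good j : (j <= m)%N -> ~ late P (m - j) (- j%:Z)%R u.
  by move=> jm lj; apply: nm; exists j.
(* For [j <= m < n], minimality of [n] gives [stuck P j u]; a draw at [-j] looking further back than
   [k] would then contradict [none]. *)
have near j : (j <= m)%N -> ~ late P k (- j%:Z)%R u.
  move=> jm lj; apply: none; exists j; split => //.
  by apply: nmin; exact: leq_ltn_trans mn.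
have E D : (forall n, (D n <= n)%N) -> coalescent D ->
    coded_path D u 0%R = hist D u (- m%:Z)%R m.+1 0%N.
  move=> DD cD; apply: coded_pathE; exists m => i mi; rewrite sub0r.
  exact: not_stuck_hist good _ mi.
move/eqP: neq; apply; rewrite E ?E//; last 3 first.
- by move=> i; exact: geq_minr.
- exact: coalescent_minn.
- exact: coalescent_id.
(* Both chains now start at [-m]. For [i <= k] they use the same depth [i]; afterwards [near] puts
   every draw below [alpha_k]. *)
have := @hist_agree _ _ P mu id (minn k) u (- m%:Z)%R 0 m.+1 (geq_minr k).
rewrite addr0 add0n; apply => // i; rewrite ltnS => im; rewrite add0n.
have [ik|ki] := leqP i k; [by left|right].
exists k; split => // [|x xh]; first exact: ltnW.
apply: (not_late_lt (ltnW ki) _ xh).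
have := near (m - i)%N (leq_subr _ _).
by have -> : (- (m - i)%N%:Z = - m%:Z + i%:Z)%R by lia.
Qed.

Context (cP : compatible mu P) (lam : probability (noise R) R)
  (lamE : iid_noise lam).
Hypothesis regP : 0 < lam (regenerates P).

Definition always_stuck : set (noise R) := \bigcap_(n in [set: nat]) stuck P n.

Lemma measurable_always_stuck : measurable always_stuck.
Proof. by apply: bigcap_measurable => // n _; exact: measurable_stuck. Qed.

(** The products [lam (stuck P n) * lam (regenerates P)] have a finite sum, so their tails tend to
    0, and each tail is at least [lam always_stuck * lam (regenerates P)]. *)
Lemma always_stuck0 : lam always_stuck = 0.
Proof.
have st0 n : 0 <= lam (stuck P n) * lam (regenerates P).
  by apply: mule_ge0; exact: measure_ge0.
have := @nneseries_tail_cvg _ (fun n =>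
  lam (stuck P n) * lam (regenerates P)) xpredT
  (le_lt_trans (sum_stuck_le1 P lamE) (ltry 1)) (fun n _ => st0 n).
move=> cv; have : lam always_stuck * lam (regenerates P) <= 0.
  have <- := cvg_lim (@ereal_hausdorff R) cv.
  apply: lime_ge; first by apply/cvg_ex; exists 0.
  apply: nearW => L; apply: (@le_trans _ _ (lam (stuck P L) * lam
    (regenerates P))).
    apply: lee_wpmul2r; first exact: measure_ge0.
    apply: le_measure; rewrite ?inE.
    - exact: measurable_always_stuck.
    - exact: measurable_stuck.
    - by move=> u; exact.
  have := @nneseries_lim_ge _ (fun n =>
    lam (stuck P n) * lam (regenerates P)) xpredT
    L L.+1 (fun n _ _ => st0 n).
  by rewrite big_nat1.
move=> h; have : lam always_stuck * lam (regenerates P) = 0.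
  by apply/eqP; rewrite eq_le h mule_ge0 ?measure_ge0.
by move=> /eqP; rewrite mule_eq0 (gt_eqF regP) orbF => /eqP.
Qed.

Let stuck_at (j : int) : set (noise R) := translate j @^-1` always_stuck.

Let measurable_stuck_at j : measurable (stuck_at j).
Proof.
rewrite -[X in measurable X]setTI; apply: measurable_translate => //.
exact: measurable_always_stuck.
Qed.

Let stuck_at0 j : lam (stuck_at j) = 0.
Proof. by rewrite /stuck_at iid_translate ?always_stuck0//;
  exact: measurable_always_stuck. Qed.

Lemma eventual_letter_translate D u j a :
  eventual_letter D (translate j u) 0%R a <-> eventual_letter D u j a.
Proof.
have E n : hist D (translate j u) (0 - n%:Z)%R n.+1 = hist D u (j - n%:Z)%R n.+1.
  by rewrite hist_translate; congr (hist _ _ _ _); lia.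
by split=> -[n0 h]; exists n0 => n /h; rewrite E.
Qed.

Lemma coded_eventually D u j : (forall n, (D n <= n)%N) -> coalescent D ->
  ~ stuck_at j u -> eventual_letter D u j (coded_path D u j).
Proof.
move=> DD cD nb; have [n nst] : exists n, ~ stuck P n (translate j u).
  by apply: contrapT => h; apply: nb => n _; apply: contrapT => nst; apply: h;
    exists n.
have [a /eventual_letter_translate ea] := not_stuck_eventual DD cD nst.
by rewrite (coded_pathE ea).
Qed.

(** Off a null event, the last [L] letters of the limit path are those of all chains started early
    enough. For these [hist_law] gives the bound, which passes to the increasing union of the sets
    [C n0]. *)
Lemma coded_path_law D nu L x : coalescent D -> follows mu D nu ->
  lam (coded_path D @^-1` last_block L x) <= nu (last_block L x).
Proof.
move=> cD F; have DD := follows_le F.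
pose E n : set (noise R) := [set u | same_first L x (hist D u (- n%:Z)%R n)].
have mE n : measurable (E n).
  by apply: (@measurable_same_first A _ (noise R)) => i a; exact: measurable_hist.
have leE n : (L <= n)%N -> lam (E n) <= nu (last_block L x).
  move=> Ln; apply: (@le_measure_strings A R _ (noise R) _ path lam nu
    (fun u => hist D u (- n%:Z)%R n) (@past_of N) point n (same_first L x)).
  - by move=> i a; exact: measurable_hist.
  - by move=> i a; exact: measurable_letter_at.
  - by move=> y; exact: hist_law.
  - by move=> y z yz h i iL; rewrite -h// yz// (leq_trans iL).
pose C n0 := \bigcap_(n in [set n | (L <= n)%N /\ (n0 <= n)%N]) E n.
have mC n0 : measurable (C n0).
  apply: bigcap_measurable => // ; exists (maxn L n0) => /=.
  by rewrite leq_maxl leq_maxr.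
have mUC : measurable (\bigcup_n C n) by exact: bigcup_measurable.
have mB : measurable (\bigcup_i stuck_at (- (i.+1)%:Z)%R).
  by apply: bigcup_measurable => i _; exact: measurable_stuck_at.
have leC : lam (\bigcup_n C n) <= nu (last_block L x).
  have ndC : nondecreasing_seq C.
    move=> n0 n1 n01; apply/subsetPset => u h n [Ln n1n]; apply: h; split => //.
    exact: leq_trans n1n.
  have cvC := @nondecreasing_cvg_mu _ _ _ lam C mC mUC ndC.
  rewrite -(cvg_lim _ cvC)//; apply: lime_le.
    by apply/cvg_ex; eexists; exact: cvC.
  apply: nearW => n0 /=; apply: le_trans (leE (maxn L n0) (leq_maxl _ _)).
  apply: le_measure; rewrite ?inE// => u; apply; split;
    [exact: leq_maxl|exact: leq_maxr].
have B0 : lam (\bigcup_i stuck_at (- (i.+1)%:Z)%R) = 0.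
  apply/negligibleP => //; apply: negligible_bigcup => i.
  by apply/negligibleP; [exact: measurable_stuck_at|exact: stuck_at0].
have mX : measurable (coded_path D @^-1` last_block L x : set (noise R)).
  rewrite -[X in measurable X]setTI.
  by apply: measurable_coded_path => //; exact: measurable_last_block.
have sub : coded_path D @^-1` last_block L x `<=`
    (\bigcup_i stuck_at (- (i.+1)%:Z)%R) `|` \bigcup_n C n.
  move=> u /= h; have [|nb] :=
    pselect ((\bigcup_i stuck_at (- (i.+1)%:Z)%R) u); first by left.
  right; have ev i : exists n0, (i < L)%N -> forall n, (n0 <= n)%N ->
      hist D u (- (i.+1)%:Z - n%:Z)%R n.+1 0%N = x i.
    have nbi : ~ stuck_at (- (i.+1)%:Z)%R u by move=> b; apply: nb; exists i.
    have [n0 hn] := coded_eventually DD cD nbi; exists n0 => iL n n0n.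
    by rewrite hn//; exact: h.
  (* A start at [-n] precedes the time [-(i+1)] by [n - i.+1] steps, so [n >= f i + i.+1] is
     required for each [i < L]; the sum bounds all these thresholds at once. *)
  have /choice[f fP] := ev; exists (\sum_(i < L) (f i + i.+1))%N =>
    // n /= [Ln fn] i iL.
  have fi : (f i + i.+1 <= n)%N.
    by apply: leq_trans fn; rewrite (bigD1 (Ordinal iL))//= leq_addr.
  rewrite hist_nth; last lia.
  have := fP i iL (n - i.+1)%N; have -> : ((n - i.+1).+1 = n - i)%N by lia.
  have -> : (- (i.+1)%:Z - (n - i.+1)%N%:Z = - n%:Z)%R by lia.
  by apply; lia.
apply: (@le_trans _ _ (lam ((\bigcup_i stuck_at (-
  (i.+1)%:Z)%R) `|` \bigcup_n C n))).
  by apply: le_measure; rewrite ?inE//; exact: measurableU.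
apply: (le_trans (measureU2 _ _ _)) => //.
by rewrite [X in X + _]B0 add0e.
Qed.

Lemma coded_path_stationary D (mD : forall n, (D n <= n)%N) :
  stationary (image_law lam (measurable_coded_path mD)).
Proof.
move=> B mB; have mX : measurable (coded_path D @^-1` B : set (noise R)).
  by rewrite -[X in measurable X]setTI; exact: measurable_coded_path.
transitivity (lam (translate 1%R @^-1` (coded_path D @^-1` B))).
  have E : @time_shift N \o coded_path D = coded_path D \o translate 1%R.
    by apply/funext => u; exact/esym/(coded_path_translate D u 1%R).
  exact: (congr1 (fun f : noise R -> path => lam (f @^-1` B)) E).
by apply: etrans (iid_translate lamE 1%R mX) _; rewrite image_lawE.
Qed.

Lemma coded_path_image D nu (F : follows mu D nu) : coalescent D ->
  forall B, measurable B -> lam (coded_path D @^-1` B) = nu B.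
Proof.
move=> cD B mB.
apply: (stationary_law_unique (coded_path_stationary (follows_le F))
  (follows_stationary F) _ mB) => L x.
exact: coded_path_law.
Qed.

Lemma coded_path_neq_law k :
  let S := [set u : noise R | coded_path id u 0%R != coded_path (minn k) u 0%R] in
  measurable S -> lam S <= (fine (lam (regenerates P)))^-1%:E * lam (late P k 0).
Proof.
move=> S mS.
pose G n := late P k (- n%:Z)%R `&` stuck P n.
have mG n : measurable (G n).
  by apply: measurableI; [exact: measurable_late|exact: measurable_stuck].
have mUG : measurable (\bigcup_n G n) by exact: bigcup_measurable.
have mas := measurable_always_stuck.
apply: (@le_trans _ _ (lam (always_stuck `|` \bigcup_n G n))).
  apply: le_measure; [exact/mem_set|exact/mem_set/measurableU|].
  - move=> u neq; have [|ns] := pselect (always_stuck u); [by left|right].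
    have [n nst] : exists n, ~ stuck P n u.
      by apply: contrapT => h; apply: ns => n _; apply: contrapT => nst;
        apply: h; exists n.
    by have [n' [h1 h2]] := coded_path_neq (ex_intro _ n nst) neq; exists n'.
apply: (le_trans (measureU2 _ _ _)) => //;
  rewrite [X in X + _]always_stuck0 add0e.
apply: (@le_trans _ _ (\sum_(n <oo) (lam (late P k 0) * lam (stuck P n)))).
  have h := measure_sigma_subadditive lam mG mUG (@subset_refl _ _).
  apply: (le_trans h).
  apply: lee_nneseries => n *; first exact: measure_ge0.
  by rewrite -late_stuck_indep.
have lf : lam (late P k 0) \is a fin_num by rewrite fin_num_measure//;
  exact: measurable_late.
rewrite -(fineK lf) nneseriesZl; last by move=> *; exact: measure_ge0.
rewrite muleC; apply: lee_wpmul2r; first by rewrite fineK ?measure_ge0.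
have mr := measurable_regenerates P.
have rf : lam (regenerates P) \is a fin_num by rewrite fin_num_measure.
have rp : (0 < fine (lam (regenerates P)))%R by rewrite fine_gt0// regP/=
  -ge0_fin_numE ?measure_ge0.
rewrite -[leRHS]mule1 lee_pdivlMl// -nneseriesZl; last by move=> *;
  exact: measure_ge0.
rewrite fineK//; under eq_eseriesr do rewrite muleC.
exact: sum_stuck_le1.
Qed.

Lemma dbar_le k nu : stationary mu -> canonical_markov k mu nu ->
  dbar mu nu <= (fine (lam (regenerates P)))^-1%:E * lam (late P k 0).
Proof.
move=> st cm.
have Fid := follows_id st; have Fk := follows_canonical st cm.
have mid := measurable_coded_path (follows_le Fid).
have mk := measurable_coded_path (follows_le Fk).
have mpair : measurable_fun setT
    (fun u : noise R => (coded_path id u, coded_path (minn k) u) : path * path).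
  by apply/measurable_fun_pairP; split; [exact: mid|exact: mk].
pose pi := image_law lam mpair.
have mdiff : measurable [set w : path * path | w.1 0%R != w.2 0%R].
  rewrite (_ : mkset _ = ~` \bigcup_(n in [set: nat])
    (if @pickle_inv A n is Some a then
    [set w : path * path | w.1 0%R = a] `&` [set w : path * path | w.2 0%R = a]
      else set0)).
    apply: measurableC; apply: bigcup_measurable => n _; case: pickle_inv => // a.
    have m0 := measurable_letter_at 0%R a.
    apply: measurableI.
      by have := @measurable_fst _ _ path path measurableT _ m0; rewrite setTI.
    by have := @measurable_snd _ _ path path measurableT _ m0; rewrite setTI.
  apply/seteqP; split => w /= h.
    move=> [n _]; case: pickle_inv => // a [/= h1 h2].
    by rewrite h1 h2 eqxx in h.
  apply/eqP => E; apply: h; exists (pickle (w.1 0%R)) => //.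
  by rewrite pickleK_inv; split.
pose shift2 (w : path * path) := (time_shift w.1, time_shift w.2).
pose f u : path * path := (coded_path id u, coded_path (minn k) u).
(* Both paths are read off the same draws and commute with translations, so translation invariance
   of the noise makes the pair jointly stationary. *)
have E : shift2 \o f = f \o translate 1%R.
  apply/funext => u; rewrite /f /shift2 /= (coded_path_translate id u 1%R).
  by rewrite (coded_path_translate (minn k) u 1%R).
have cpi : stationary_coupling mu nu pi.
  split.
  - by move=> B mB; exact: (coded_path_image Fid coalescent_id mB).
  - by move=> B mB; exact: (coded_path_image Fk (@coalescent_minn k) mB).
  - move=> C mC.
    have mX : measurable ((fun u : noise R =>
      (coded_path id u, coded_path (minn k) u) : path * path) @^-1` C).
      by rewrite -[X in measurable X]setTI; exact: (mpair).
    transitivity (lam (translate 1%R @^-1` ((fun u : noise R =>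
      (coded_path id u, coded_path (minn k) u) : path * path) @^-1` C))).
      exact: (congr1 (fun f : noise R -> path * path => lam (f @^-1` C)) E).
    by apply: etrans (iid_translate lamE 1%R mX) _; rewrite image_lawE.
apply: (@le_trans _ _ (pi [set w | w.1 0%R != w.2 0%R])).
  by apply: ereal_inf_lbound; exists pi.
have mneq := mpair measurableT _ mdiff; rewrite setTI in mneq.
exact: coded_path_neq_law mneq.
Qed.

End coupling.

(** * Transfer to the given uniform variables and conclusion *)

Lemma measurable_noise_of (R : realType) d (Omega : measurableType d)
    (Pr : probability Omega R) (U : int -> {RV Pr >-> R}) :
  measurable_fun setT (fun omega => (fun n => U n omega) : noise R).
Proof. by apply: measurable_fun_noise => i; exact: measurable_funPT. Qed.

Lemma iid_noise_of (R : realType) d (Omega : measurableType d)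
    (Pr : probability Omega R) (U : int -> {RV Pr >-> R}) :
  iid_uniform U -> iid_noise (image_law Pr (measurable_noise_of U)).
Proof.
move=> hU s B us mB; rewrite image_lawE.
transitivity (\prod_(n <- s) Pr (U n @^-1` B n))%E.
  by rewrite -(iid_independent hU us mB).
by under eq_bigr do rewrite (iid_law hU)//.
Qed.

Theorem theorem4p2 (R : realType) (N : alphabet_size)
    (P : letter N -> past_space N -> R) (hP : is_kernel P)
    (d : measure_display) (Omega : measurableType d) (Pr : probability Omega R)
    (U : int -> {RV Pr >-> R}) (hU : iid_uniform U)
    (hprod : (\int[Pr]_omega inv_prod P (fun n => U n omega) < +oo)%E)
    (mu : probability (path_space N) R)
    (mu_stat : stationary mu) (mu_comp : compatible mu P)
    (muk : nat -> probability (path_space N) R)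
    (hmuk : forall k, canonical_markov k mu (muk k)) :
  exists2 C : R, 0 < C &
    forall k : nat,
      (dbar mu (muk k) <=
       C%:E * Pr [set omega | k%:R%:E < ell P (fun n => U n omega)])%E.
Proof.
pose mX := measurable_noise_of U.
pose lam := image_law Pr mX.
have lamE : iid_noise lam := iid_noise_of hU.
have a0 := alpha0_gt0 hP (X := fun omega => (fun n => U n omega) : noise R) hprod.
have sl : (\sum_(k <oo) lam (late P k 0) < +oo)%E.
  by apply: (summable_late hP lamE (X := mfun_Sub (mem_set mX))).
have rp := regenerates_gt0 hP lamE a0 sl.
have rf : lam (regenerates P) \is a fin_num.
  by rewrite fin_num_measure//; exact: measurable_regenerates.
exists (fine (lam (regenerates P)))^-1.
  by rewrite invr_gt0 fine_gt0// rp/= -ge0_fin_numE// measure_ge0.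
move=> k; apply: (le_trans (dbar_le hP mu_comp lamE rp mu_stat (hmuk k))).
by rewrite -ell_lateE.
Qed.
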